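(* Let $\mathcal M$ be a semifinite von Neumann algebra with a faithful normal semifinite trace $\tau$, $\tau(\mathbf 1)=\infty$. The space $L^0(\mathcal M,\tau)$ is complete with respect to almost uniform (a.u.) convergence and with respect to bilaterally almost uniform (b.a.u.) convergence. That is, for every directed set $(\Lambda,\leq)$ and every net $\{x_\alpha\}_{\alpha\in\Lambda}\subset L^0(\mathcal M,\tau)$: if $\{x_\alpha\}$ is a.u. Cauchy (respectively, b.a.u. Cauchy), then there exists $\widehat x\in L^0(\mathcal M,\tau)$ such that $x_\alpha\to\widehat x$ a.u. (respectively, b.a.u.).
   Context: $\mathcal P(\mathcal M)$ is the lattice of projections in $\mathcal M$, $\mathbf 1$ is the identity of $\mathcal M$, and $e^\perp=\mathbf 1-e$ for $e\in\mathcal P(\mathcal M)$. $L^0=L^0(\mathcal M,\tau)$ is the $*$-algebra of $\tau$-measurable operators affiliated with $\mathcal M$, and $\|\cdot\|_\infty$ is the uniform (operator) norm in $\mathcal M$, with the convention $\|y\|_\infty=\infty$ for $y\in L^0\setminus\mathcal M$. A net $\{x_\alpha\}_{\alpha\in\Lambda}\subset L^0$ converges to $\widehat x\in L^0$ almost uniformly (a.u.) (respectively, bilaterally almost uniformly (b.a.u.)) if for every $\varepsilon>0$ there exists $e\in\mathcal P(\mathcal M)$ such that $\tau(e^\perp)\leq\varepsilon$ and $\|(\widehat x-x_\alpha)e\|_\infty\to 0$ (respectively, $\|e(\widehat x-x_\alpha)e\|_\infty\to 0$). A net $\{x_\alpha\}_{\alpha\in\Lambda}\subset L^0$ is a.u.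 Cauchy (respectively, b.a.u. Cauchy) if for every $\varepsilon>0$ there exists $e\in\mathcal P(\mathcal M)$ with $\tau(e^\perp)\leq\varepsilon$ such that for every $\delta>0$ there is $\gamma\in\Lambda$ with $\|(x_\alpha-x_\beta)e\|_\infty\leq\delta$ (respectively, $\|e(x_\alpha-x_\beta)e\|_\infty\leq\delta$) for all $\alpha,\beta\geq\gamma$. *)

(* Defs.v *)
From HB Require Import structures.
From mathcomp Require Import all_boot all_order all_algebra.
From mathcomp Require Import sesquilinear complex.
From mathcomp Require Import all_classical all_reals all_analysis.

Set Implicit Arguments.
Unset Strict Implicit.
Unset Printing Implicit Defensive.
Import Order.TTheory GRing.Theory Num.Theory Num.Def.
Import numFieldNormedType.Exports.
Local Open Scope classical_set_scope.
Local Open Scope ring_scope.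

(* A complex Hilbert space is a complete normed space [H] over [R[i]] with a
   positive definite Hermitian form [dot] (linear in its first argument) that
   induces the norm. Operators in B(H) are plain functions [H -> H] that satisfy
   [bounded_op]; possibly unbounded operators are given by their graphs, which
   are sets in [H * H]. *)

Definition induces_norm (R : realType) (H : completeNormedModType R[i])
    (dot : {dot H for conjC}) : Prop :=
  forall v : H, `|v| ^+ 2 = dot v v.

Section BoundedOperators.
Context {R : realType} {H : completeNormedModType R[i]}.
Variable dot : {dot H for conjC}.
Implicit Types (a b u : H -> H) (A : set (H -> H)).

Definition bounded_op a : Prop := linear a /\ continuous a.

Definition adjoint_op a b : Prop := forall v w, dot (a v) w = dot v (b w).

Definition commutant A : set (H -> H) :=
  [set b | bounded_op b /\ forall a, A a -> a \o b = b \o a].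

(* [0 <= z] in [R[i]] means that [z] is real and nonnegative. *)
Definition op_le a b : Prop := forall v, 0 <= dot (b v - a v) v.

Definition unitary_op u : Prop :=
  bounded_op u /\ exists2 v, adjoint_op u v & u \o v = id /\ v \o u = id.

Record von_neumann_algebra (M : set (H -> H)) : Prop := {
  vna_bounded : forall a, M a -> bounded_op a ;
  vna_lin : forall (c : R[i]) a b, M a -> M b -> M (fun v => c *: a v + b v) ;
  vna_one : M id ;
  vna_mul : forall a b, M a -> M b -> M (a \o b) ;
  vna_adj : forall a, M a -> exists2 b, M b & adjoint_op a b ;
  vna_bicommutant : commutant (commutant M) = M }.

Section Algebra.
Variable M : set (H -> H).

Definition positive_part : set (H -> H) := [set a | M a /\ op_le (fun=> 0) a].

Definition projections : set (H -> H) :=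
  [set e | [/\ M e, adjoint_op e e & e \o e = e]].

Definition perp a : H -> H := fun v => v - a v.

Definition op_directed A : Prop :=
  A !=set0 /\ forall a b, A a -> A b -> exists2 c, A c & op_le a c /\ op_le b c.

Definition op_lub A a : Prop :=
  [/\ positive_part a, forall b, A b -> op_le b a &
      forall c, positive_part c -> (forall b, A b -> op_le b c) -> op_le a c].

(* Only the values of [tau] on [positive_part] are meaningful. In [\bar R],
   [0 * +oo = 0]. *)
Record fns_trace (tau : (H -> H) -> \bar R) : Prop := {
  tr_ge0 : forall a, positive_part a -> (0 <= tau a)%E ;
  tr_add : forall a b, positive_part a -> positive_part b ->
    tau (fun v => a v + b v) = (tau a + tau b)%E ;
  tr_scale : forall (c : R) a, 0 <= c -> positive_part a ->
    tau (fun v => c%:C%C *: a v) = (c%:E * tau a)%E ;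
  tr_tracial : forall a b, M a -> M b -> adjoint_op a b ->
    tau (b \o a) = tau (a \o b) ;
  tr_faithful : forall a, positive_part a -> tau a = 0%E -> a = fun=> 0 ;
  tr_normal : forall A a, A `<=` positive_part -> op_directed A -> op_lub A a ->
    tau a = ereal_sup (tau @` A) ;
  tr_semifinite : forall a, positive_part a -> a <> (fun=> 0) ->
    exists b, [/\ positive_part b, b <> (fun=> 0), op_le b a
                & (tau b < +oo)%E] }.

End Algebra.
End BoundedOperators.

Section MeasurableOperators.
Context {R : realType} {H : completeNormedModType R[i]}.
Variables (dot : {dot H for conjC}) (M : set (H -> H)).
Variable tau : (H -> H) -> \bar R.
Implicit Types (x y : set (H * H)) (e : H -> H).

Definition op_graph (a : H -> H) : set (H * H) := [set p | p.2 = a p.1].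

Definition op_dom x : set H := [set v | exists w, x (v, w)].

Definition linear_graph x : Prop :=
  [/\ x (0, 0),
      forall (c : R[i]) v w v' w', x (v, w) -> x (v', w') ->
        x (c *: v + v', c *: w + w')
    & forall v w w', x (v, w) -> x (v, w') -> w = w'].

(* x = u^* x u for every unitary u in the commutant of M *)
Definition affiliated x : Prop :=
  forall u, commutant M u -> unitary_op dot u ->
  forall v w, x (v, w) <-> x (u v, u w).

Definition tau_measurable x : Prop :=
  forall eps : R, 0 < eps -> exists e,
    [/\ projections dot M e, (tau (perp e) <= eps%:E)%E
      & range e `<=` op_dom x].

Definition L0 : set (set (H * H)) :=
  [set x | [/\ linear_graph x, closed x, dense (op_dom x),
               affiliated x & tau_measurable x]].

(* The operations of the *-algebra L0 are the strong ones: the closures of the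
   algebraic difference and of the algebraic product. *)
Definition L0_sub x y : set (H * H) :=
  closure [set p | exists w w', [/\ x (p.1, w), y (p.1, w') & p.2 = w - w']].

Definition L0_mul x y : set (H * H) :=
  closure [set p | exists2 w, y (p.1, w) & x (w, p.2)].

(* The operator norm of an element of [M]; [+oo], the infimum of the empty set,
   if [x] is not the graph of an element of [M]. *)
Definition unorm x : \bar R :=
  ereal_inf [set c%:E | c in [set c : R | 0 <= c /\
    exists a, [/\ M a, x = op_graph a & forall v, `|a v| <= c%:C%C * `|v|]]].

Section Nets.
Variables (Idx : Type) (le : Idx -> Idx -> Prop).
Implicit Types (xs : Idx -> set (H * H)) (xh : set (H * H)).

Definition directed_set : Prop :=
  [/\ inhabited Idx, forall i, le i i,
      forall i j k, le i j -> le j k -> le i k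
    & forall i j, exists2 k, le i k & le j k].

Definition tails : set_system Idx := filter_from setT (fun g => [set i | le g i]).

Definition au_cvg xs xh : Prop :=
  forall eps : R, 0 < eps -> exists e,
    [/\ projections dot M e, (tau (perp e) <= eps%:E)%E
      & (fun i => unorm (L0_mul (L0_sub xh (xs i)) (op_graph e))) @ tails
          --> 0%E].

Definition bau_cvg xs xh : Prop :=
  forall eps : R, 0 < eps -> exists e,
    [/\ projections dot M e, (tau (perp e) <= eps%:E)%E
      & (fun i => unorm (L0_mul (op_graph e)
                          (L0_mul (L0_sub xh (xs i)) (op_graph e)))) @ tails
          --> 0%E].

Definition au_cauchy xs : Prop :=
  forall eps : R, 0 < eps -> exists e,
    [/\ projections dot M e, (tau (perp e) <= eps%:E)%E
      & forall delta : R, 0 < delta -> exists g, forall i j, le g i -> le g j ->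
          (unorm (L0_mul (L0_sub (xs i) (xs j)) (op_graph e)) <= delta%:E)%E].

Definition bau_cauchy xs : Prop :=
  forall eps : R, 0 < eps -> exists e,
    [/\ projections dot M e, (tau (perp e) <= eps%:E)%E
      & forall delta : R, 0 < delta -> exists g, forall i j, le g i -> le g j ->
          (unorm (L0_mul (op_graph e)
                    (L0_mul (L0_sub (xs i) (xs j)) (op_graph e)))
             <= delta%:E)%E].

End Nets.
End MeasurableOperators.

(* Main.v *)
Require Import Defs.
From HB Require Import structures.
From mathcomp Require Import all_boot all_order all_algebra.
From mathcomp Require Import sesquilinear complex.
From mathcomp Require Import all_classical all_reals all_analysis.
From mathcomp Require Import ring lra.
Import Order.TTheory GRing.Theory Num.Theory Num.Def.
Import numFieldNormedType.Exports.
Set Implicit Arguments.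
Unset Strict Implicit.
Unset Printing Implicit Defensive.
Local Open Scope classical_set_scope.
Local Open Scope ring_scope.

(** Almost uniform and bilaterally almost uniform convergence are treated
together: both control the strong product [p (x_i - x_j) e], with [p = 1] in
the first case and [p = e] in the second ([left_factor]).

A Cauchy net contains a sequence [x_(s k)] such that
[p (x_(s (k+1)) - x_(s k)) e_k] has norm at most [2^-k] while
[tau (e_k^perp) <= 2^-k]. The sequence even converges almost uniformly,
because the left factor can be dropped at the cost of a smaller projection. If
[e y e] has norm at most [c], then [y] is bounded by [c] on the vectors in the
range of [e] that [e^perp y] annihilates; the vectors lost in this way span the
right support of [e^perp y e], and the trace of a right support is at most
twice that of a projection that dominates the left support ([tau_ker],
[bounded_step]). So there are projections [f n] increasing to the identity,
with [tau ((f n)^perp)] summable, on whose ranges [x_(s k)] converges uniformly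
as [k] grows. The limit [xh] is defined on the union of these ranges and then
closed ([limit_operator]). The whole net converges to [xh] since
[p (xh - x_i) e = p (xh - x_(s k)) e + p (x_(s k) - x_i) e], where the first
term is small on a range of [f n] and the second by the Cauchy condition
([complete_net]).

Two points about unbounded operators remain: why the limit is closable, and why
the last identity holds for strong (closed) differences, although the
domains of all the [x_i] need not have a dense intersection. Both are settled by the
class of [tame] relations: linear relations, stable under the commutant, that
are bounded on the range of a projection of small co-trace, and become bounded
when multiplied on the left by another such projection. The second property
survives limits, so it makes closures single-valued. For a relation that lives
on an increasing union of ranges it follows from the first one: the increments
of the bounded restrictions have small right supports, hence small left
supports, and these are cut off ([left_bound]). A closed affiliated operator is
the closure of its restriction to any domain that contains the ranges of
projections of arbitrarily small co-trace ([core_closure]), so the elements of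
L0 are tame, and a strong difference can be undone: [y u = x u - (x - y) u]
whenever the right-hand side makes sense ([sub_cancel]).

Operators are shown to lie in the algebra by the bicommutant property. They are
obtained from orthogonal projections onto closed relations in the square of the
Hilbert space, which commute with the commutant. Affiliation only speaks of
the unitaries of the commutant; Cayley transforms reach the other elements
([affiliated_stable]). *)

(** * Real-valued norms and convergence of sequences *)

Section RealNorm.
Context {R : realType} {V : normedModType R[i]}.
Implicit Types u v w : V.

Definition nrm v : R := complex.Re `|v|.

Lemma nrmE v : `|v| = (nrm v)%:C%C.
Proof. by rewrite /nrm RRe_real// normr_real. Qed.

Lemma nrm_ge0 v : 0 <= nrm v.
Proof. by have := normr_ge0 v; rewrite nrmE ler0c. Qed.

Lemma nrm0 : nrm 0 = 0 :> R.
Proof. by rewrite /nrm normr0. Qed.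

Lemma nrm_eq0 v : nrm v = 0 -> v = 0.
Proof. by move=> v0; apply/eqP; rewrite -normr_eq0 nrmE v0. Qed.

Lemma nrmD u v : nrm (u + v) <= nrm u + nrm v.
Proof. by rewrite -lecR rmorphD/= -!nrmE ler_normD. Qed.

Lemma nrmN v : nrm (- v) = nrm v.
Proof. by rewrite /nrm normrN. Qed.

Lemma nrmBC u v : nrm (u - v) = nrm (v - u).
Proof. by rewrite -nrmN opprB. Qed.

Lemma nrm_dist u v w : nrm (u - w) <= nrm (u - v) + nrm (v - w).
Proof. by rewrite -[u - w](subrKA v) nrmD. Qed.

Lemma nrmZ (c : R) v : nrm (c%:C%C *: v) = `|c| * nrm v.
Proof.
apply: complexI; rewrite rmorphM/= -!nrmE normrZ normc_def/=.
by rewrite expr0n/= addr0 sqrtr_sqr.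
Qed.

Lemma nrmZC (c : R[i]) v : nrm (c *: v) = complex.Re `|c| * nrm v.
Proof.
have cE : `|c| = (complex.Re `|c|)%:C%C by rewrite RRe_real// normr_real.
by apply: complexI; rewrite rmorphM/= -!nrmE normrZ cE.
Qed.

Lemma closureP (A : set V) v :
  closure A v <-> forall eps : R, 0 < eps -> exists2 w, A w & nrm (v - w) < eps.
Proof.
split.
  move=> clA eps eps0.
  have /clA[w [Aw]] : nbhs v (ball v eps%:C%C).
    by apply: nbhsx_ballx; rewrite ltcR.
  by rewrite -ball_normE/= nrmE ltcR => ?; exists w.
move=> clA B /nbhs_ballP[e /= e0 vB].
have e_real : e = (complex.Re e)%:C%C by rewrite RRe_real// gtr0_real.
have /clA[w Aw vw] : 0 < complex.Re e by rewrite -ltcR -e_real.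
by exists w; split=> //; apply: vB; rewrite -ball_normE/= nrmE e_real ltcR.
Qed.

Definition tends (u : nat -> V) l := forall eps : R, 0 < eps ->
  exists n0, forall n, (n0 <= n)%N -> nrm (u n - l) < eps.

Lemma tends_unique (u : nat -> V) l l' : tends u l -> tends u l' -> l = l'.
Proof.
move=> ul ul'; apply/eqP; rewrite -subr_eq0; apply/eqP/nrm_eq0/eqP.
apply: contraT => ne0; have gt0 : 0 < nrm (l - l') by rewrite lt_def ne0 nrm_ge0.
have [n0 h0] := ul _ (divr_gt0 gt0 (ltr0n _ 2)).
have [n1 h1] := ul' _ (divr_gt0 gt0 (ltr0n _ 2)).
have := h0 (maxn n0 n1) (leq_maxl _ _); have := h1 (maxn n0 n1) (leq_maxr _ _).
rewrite [nrm (_ - l)]nrmBC; have := nrm_dist l (u (maxn n0 n1)) l'; lra.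
Qed.

Lemma closed_tends (A : set V) (u : nat -> V) l :
  closed A -> (forall n, A (u n)) -> tends u l -> A l.
Proof.
move=> cA Au ul; apply: cA; apply/closureP => eps eps0.
by have [n0 h0] := ul _ eps0; exists (u n0) => //; rewrite nrmBC h0.
Qed.

Lemma tends_cst l : tends (fun=> l) l.
Proof. by move=> eps eps0; exists 0%N => n _; rewrite subrr nrm0. Qed.

Lemma tends_lin (c : R[i]) (u u' : nat -> V) l l' :
  tends u l -> tends u' l' -> tends (fun n => c *: u n + u' n) (c *: l + l').
Proof.
move=> ul ul' eps eps0.
pose C := complex.Re `|c| + 1.
have cE : `|c| = (complex.Re `|c|)%:C%C by rewrite RRe_real// normr_real.
have c0 : 0 <= complex.Re `|c| by have := normr_ge0 c; rewrite cE ler0c.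
have C0 : 0 < C by rewrite /C; lra.
have [n0 h0] := ul (eps / (2 * C)) (divr_gt0 eps0 (mulr_gt0 (ltr0n _ 2) C0)).
have [n1 h1] := ul' _ (divr_gt0 eps0 (ltr0n _ 2)).
exists (maxn n0 n1) => n; rewrite geq_max => /andP[/h0 h0n /h1 h1n].
rewrite opprD addrACA -scalerBr (le_lt_trans (nrmD _ _))//.
rewrite nrmZC.
have : complex.Re `|c| * nrm (u n - l) <= C * nrm (u n - l).
  by rewrite ler_wpM2r ?nrm_ge0// /C; lra.
have : C * nrm (u n - l) < C * (eps / (2 * C)) by rewrite ltr_pM2l.
have -> : C * (eps / (2 * C)) = eps / 2 by field; rewrite gt_eqF.
lra.
Qed.

End RealNorm.

Lemma complete_tends {R : realType} {V : completeNormedModType R[i]}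
    (u : nat -> V) : (forall eps : R, 0 < eps ->
    exists n0, forall m n, (n0 <= m)%N -> (n0 <= n)%N -> nrm (u m - u n) < eps) ->
  exists l, tends u l.
Proof.
move=> cu.
have : cvg (u @ \oo).
  apply/cauchy_cvgP/cauchy_exP => e e0.
  have e_real : e = (complex.Re e)%:C%C by rewrite RRe_real// gtr0_real.
  have /cu[n0 h0] : 0 < complex.Re e by rewrite -ltcR -e_real.
  exists (u n0); exists n0 => // n /= n0n.
  by rewrite -ball_normE/= nrmE e_real ltcR h0.
move=> /cvg_ex[l ul]; exists l => eps eps0.
have eps0' : 0 < eps%:C%C :> R[i] by rewrite ltcR.
have /cvgrPdist_lt/(_ _ eps0')[n0 _ h0] := ul.
by exists n0 => n /h0 /=; rewrite nrmE ltcR nrmBC.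
Qed.

Lemma nrm_pair {R : realType} {V : normedModType R[i]} (p : V * V) (eps : R) :
  (nrm p < eps) = (nrm p.1 < eps) && (nrm p.2 < eps).
Proof.
rewrite -ltcR -nrmE prod_normE/= -[in RHS]ltcR -[in RHS]ltcR -!nrmE.
by rewrite comparable_gt_max// real_comparable// normr_real.
Qed.

Section Sequences.
Context {R : realType} {V : normedModType R[i]}.
Implicit Types (u : nat -> V) (A : set V).

Lemma small_le0 (x C : R) : 0 <= C -> (forall eps, 0 < eps -> x <= C * eps) -> x <= 0.
Proof.
move=> C0 h; rewrite leNgt; apply/negP => x0.
have C1 : 0 < C + 1 by lra.
have C2 : 0 < 2 * (C + 1) by lra.
have := h (x / (2 * (C + 1))) (divr_gt0 x0 C2).
have : x / (2 * (C + 1)) * (2 * (C + 1)) = x by rewrite divfK// gt_eqF.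
have := divr_gt0 x0 C2; move: (x / _) => y; nra.
Qed.

Lemma half_small (eps : R) : 0 < eps ->
  exists n0 : nat, forall n, (n0 <= n)%N -> 2 ^- n < eps.
Proof.
move=> e0; exists (truncn eps^-1) => n hn.
rewrite invf_plt ?posrE ?exprn_gt0//; apply: lt_le_trans (truncnS_gt _) _.
rewrite -natrX ler_nat; apply: leq_ltn_trans hn _; exact: ltn_expl.
Qed.

Lemma closure_seqP A v : closure A v <->
  exists u, (forall n, A (u n)) /\ tends u v.
Proof.
split.
  move=> /closureP clA.
  have /choice[u hu] : forall n : nat, exists w, A w /\ nrm (v - w) < 2 ^- n.
    move=> n; have /clA[w Aw vw] : 0 < 2 ^- n :> R by rewrite invr_gt0 exprn_gt0.
    by exists w.
  exists u; split=> [n|eps e0]; first exact: (hu n).1.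
  have [n0 h0] := half_small e0; exists n0 => n /h0.
  by apply: lt_trans; rewrite nrmBC (hu n).2.
move=> [u [Au uv]]; apply/closureP => eps e0.
by have [n0 h0] := uv _ e0; exists (u n0) => //; rewrite nrmBC h0.
Qed.

Lemma closed_seq A :
  (forall u l, (forall n, A (u n)) -> tends u l -> A l) -> closed A.
Proof. by move=> h v /closure_seqP[u [Au uv]]; exact: h uv. Qed.

Lemma tendsB u u' l l' : tends u l -> tends u' l' ->
  tends (fun n => u n - u' n) (l - l').
Proof.
move=> ul ul'; have := tends_lin (- 1) ul' ul.
by rewrite scaleN1r addrC; under eq_fun do rewrite scaleN1r addrC.
Qed.

Lemma tends_nrm_le u l (C : R) :
  tends u l -> (exists n0, forall n, (n0 <= n)%N -> nrm (u n) <= C) -> nrm l <= C.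
Proof.
move=> ul [n0 uC]; rewrite -subr_le0; apply: (@small_le0 _ 1) => // eps e0.
have [n1 h] := ul _ e0; rewrite mul1r.
have := uC (maxn n0 n1) (leq_maxl _ _); have := h (maxn n0 n1) (leq_maxr _ _).
have := nrm_dist l (u (maxn n0 n1)) 0; rewrite !subr0 nrmBC; lra.
Qed.

Lemma tends_shift u l k : tends u l -> tends (fun n => u (n + k)%N) l.
Proof.
move=> ul e /ul[n0 h0]; exists n0 => n hn; apply: h0.
by rewrite (leq_trans hn)// leq_addr.
Qed.

Lemma tends_dominated u l (e : nat -> R) (C : R) : 0 <= C ->
  (forall eps, 0 < eps -> exists n0, forall n, (n0 <= n)%N -> e n < eps) ->
  (forall n, nrm (u n - l) <= C * e n) -> tends u l.
Proof.
move=> C0 e0 h eps eps0; have C1 : 0 < C + 1 by lra.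
have [n0 h0] := e0 (eps / (C + 1)) (divr_gt0 eps0 C1).
exists n0 => n /h0 hn; apply: le_lt_trans (h n) _.
have : eps / (C + 1) * (C + 1) = eps by rewrite divfK// gt_eqF.
have := divr_gt0 eps0 C1; move: (eps / _) hn => y; nra.
Qed.

End Sequences.

Section PairSequences.
Context {R : realType} {V : normedModType R[i]}.

Lemma tends_fst (u : nat -> V * V) l : tends u l -> tends (fun n => (u n).1) l.1.
Proof. by move=> ul e /ul[n0 h]; exists n0 => n /h; rewrite nrm_pair => /andP[]. Qed.

Lemma tends_snd (u : nat -> V * V) l : tends u l -> tends (fun n => (u n).2) l.2.
Proof. by move=> ul e /ul[n0 h]; exists n0 => n /h; rewrite nrm_pair => /andP[]. Qed.

Lemma tends_pair (u u' : nat -> V) l l' : tends u l -> tends u' l' ->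
  tends (fun n => (u n, u' n)) (l, l').
Proof.
move=> ul ul' e e0; have [n0 h0] := ul _ e0; have [n1 h1] := ul' _ e0.
exists (maxn n0 n1) => n; rewrite geq_max => /andP[/h0 ? /h1 ?].
by rewrite nrm_pair; apply/andP.
Qed.

End PairSequences.

(** The steps are bounded by the increments of s, so that one hypothesis gives
both the limit and the rate of convergence. *)
Lemma telescope_tends {R : realType} {V : completeNormedModType R[i]}
    (u : nat -> V) (s : nat -> R) :
  (forall n, nrm (u n.+1 - u n) <= s n - s n.+1) -> (forall n, 0 <= s n) ->
  (forall eps, 0 < eps -> exists n, s n < eps) ->
  exists l, tends u l /\ forall n, nrm (l - u n) <= s n.
Proof.
move=> us s0 s_small.
have step n k : nrm (u (n + k)%N - u n) <= s n - s (n + k)%N.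
  elim: k => [|k IH]; first by rewrite addn0 !subrr nrm0.
  rewrite addnS; have := nrm_dist (u (n + k).+1) (u (n + k)%N) (u n).
  by have := us (n + k)%N; lra.
have stepW n m : (n <= m)%N -> nrm (u m - u n) <= s n.
  by move=> /subnKC <-; apply: le_trans (step _ _) _; rewrite lerBlDr lerDl.
have [l ul] : exists l, tends u l.
  apply: complete_tends => e e0; have [n0 h0] := s_small (e / 2) (divr_gt0 e0 (ltr0n _ 2)).
  exists n0 => m n hm hn; have := stepW _ _ hm; have := stepW _ _ hn.
  by rewrite [nrm (u n - _)]nrmBC; have := nrm_dist (u m) (u n0) (u n); lra.
exists l; split=> // n; apply: (@tends_nrm_le _ _ (fun m => u m - u n)).
  by apply: tendsB => //; exact: tends_cst.
by exists n => m; exact: stepW.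
Qed.

(** * Linear maps and subspaces *)

Section Bounded.
Context {R : realType} {V : completeNormedModType R[i]}.
Implicit Types a : V -> V.

Lemma bounded_bound a : bounded_op a ->
  exists2 C : R, 0 <= C & forall v, nrm (a v) <= C * nrm v.
Proof.
move=> [la ca].
pose f : {linear V -> V} := HB.pack a (GRing.isLinear.Build _ _ _ _ _ la).
have /linear_boundedP := continuous_linear_bounded 0 (ca 0 : {for 0, continuous f}).
move=> /pinfty_ex_gt0[r r0 h].
have r_real : r = (complex.Re r)%:C%C by rewrite RRe_real// gtr0_real.
exists (complex.Re r); first by rewrite -lecR -r_real ltW.
by move=> v; rewrite -lecR rmorphM/= -!nrmE -r_real; exact: h.
Qed.

Lemma bound_bounded a (C : R) :
  linear a -> (forall v, nrm (a v) <= C * nrm v) -> bounded_op a.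
Proof.
move=> la h; split=> //.
pose f : {linear V -> V} := HB.pack a (GRing.isLinear.Build _ _ _ _ _ la).
suff : continuous f by [].
apply: bounded_linear_continuous; apply/linear_boundedP.
near=> r => v; rewrite !nrmE.
apply: (@le_trans _ _ (C%:C%C * (nrm v)%:C%C)).
  by rewrite -rmorphM/= lecR h.
rewrite ler_wpM2r ?lecR ?nrm_ge0//.
near: r; apply: nbhs_pinfty_ge; exact/complex_realP/(ex_intro _ C).
Unshelve. all: by end_near. Qed.

End Bounded.

Section LinearMaps.
Context {R : realType} {V W : lmodType R[i]}.
Implicit Types (a : V -> W) (K : set V).

Lemma lin0 a : linear a -> a 0 = 0.
Proof.
move=> la; pose f : {linear V -> W} := HB.pack a (GRing.isLinear.Build _ _ _ _ _ la).
exact: (linear0 f).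
Qed.

Lemma linD a u v : linear a -> a (u + v) = a u + a v.
Proof. by move=> la; have := la 1 u v; rewrite !scale1r. Qed.

Lemma linZ a c u : linear a -> a (c *: u) = c *: a u.
Proof. by move=> la; rewrite -[c *: u]addr0 la lin0// addr0. Qed.

Lemma linN a u : linear a -> a (- u) = - a u.
Proof. by move=> la; rewrite -scaleN1r linZ// scaleN1r. Qed.

Lemma linB a u v : linear a -> a (u - v) = a u - a v.
Proof. by move=> la; rewrite linD// linN. Qed.

(** Stated for sets, so that it applies to domains in H as well as to linear
relations in [H * H]. *)
Definition subsp K := K 0 /\ forall c v w, K v -> K w -> K (c *: v + w).

Lemma subspD K u v : subsp K -> K u -> K v -> K (u + v).
Proof. by move=> [_ h] Ku Kv; rewrite -[u]scale1r; exact: h. Qed.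

Lemma subspZ K c u : subsp K -> K u -> K (c *: u).
Proof. by move=> [h0 h] Ku; rewrite -[_ *: _]addr0; exact: h. Qed.

Lemma subspN K u : subsp K -> K u -> K (- u).
Proof. by move=> hK Ku; rewrite -scaleN1r; exact: subspZ. Qed.

Lemma subspB K u v : subsp K -> K u -> K v -> K (u - v).
Proof. by move=> hK Ku Kv; apply: subspD => //; exact: subspN. Qed.

End LinearMaps.

Lemma re_im_scale {R : realType} {V : lmodType R[i]} (c : R[i]) (v : V) :
  c *: v = (complex.Re c)%:C%C *: v + (complex.Im c)%:C%C *: ('i%C *: v).
Proof. by rewrite scalerA -scalerDl {1}[c]complexE mulrC. Qed.

(** * Orthogonal projection in the Hilbert space and its square *)

Section RealPart.
Context {R : realType}.
Implicit Types x y : R[i].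

Let ReD x y : complex.Re (x + y) = complex.Re x + complex.Re y.
Proof. by case: x => ? ?; case: y. Qed.

Let ReN x : complex.Re (- x) = - complex.Re x.
Proof. by case: x. Qed.

Let ReZ (c : R) x : complex.Re (c%:C%C * x) = c * complex.Re x.
Proof. by case: x => ? ? /=; rewrite mul0r subr0. Qed.

Let ReJ x : complex.Re ('i%C * x) = - complex.Re (('i%C)^*%C * x).
Proof. by case: x => ? ? /=; lra. Qed.

Definition ReE := (ReD, ReN, ReZ, ReJ).

End RealPart.

Section InnerProduct.
Context {R : realType} {H : completeNormedModType R[i]}.
Context (dot : {dot H for conjC}) (hdot : induces_norm dot).
Implicit Types u v w : H.

Definition reip v w : R := complex.Re (dot v w).
Local Notation ip := reip.

Lemma dotC u v : dot u v = (dot v u)^*%C.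
Proof.
rewrite (hermC dot) expr0 mul1r.
by rewrite /Num.conj.
Qed.

Lemma dotZr c u v : dot u (c *: v) = c^*%C * dot u v.
Proof. by rewrite dotC linearZl_LR rmorphM/= [in RHS]dotC. Qed.

Lemma dotDl u v w : dot (u + v) w = dot u w + dot v w.
Proof. exact: linearDl. Qed.

Lemma dotBl u v w : dot (u - v) w = dot u w - dot v w.
Proof. exact: linearBl. Qed.

Lemma dotZl c u w : dot (c *: u) w = c * dot u w.
Proof. exact: linearZl_LR. Qed.

Lemma dot0l w : dot 0 w = 0.
Proof. exact: linear0l. Qed.

(** The real part determines the form, which lets the sequel argue with the
real-valued [reip] and linear arithmetic over [R]. *)
Lemma dotE u v : dot u v = (ip u v +i* ip u ('i%C *: v))%C.
Proof.
by rewrite /ip dotZr; case: (dot u v) => a b /=; simpc.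
Qed.

Lemma ipC u v : ip u v = ip v u.
Proof. by rewrite /ip dotC; case: (dot v u). Qed.

Lemma ipDl u v w : ip (u + v) w = ip u w + ip v w.
Proof. by rewrite /ip linearDl ReE. Qed.

Lemma ipNl u w : ip (- u) w = - ip u w.
Proof. by rewrite /ip linearNl ReE. Qed.

Lemma ipZl (c : R) u w : ip (c%:C%C *: u) w = c * ip u w.
Proof. by rewrite /ip linearZl_LR ReE. Qed.

Lemma ipJ u w : ip ('i%C *: u) w = - ip u ('i%C *: w).
Proof. by rewrite /ip linearZl_LR ReE dotZr. Qed.

Lemma ipDr u v w : ip u (v + w) = ip u v + ip u w.
Proof. by rewrite ipC ipDl !(ipC u). Qed.

Lemma ipNr u w : ip u (- w) = - ip u w.
Proof. by rewrite ipC ipNl ipC. Qed.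

Lemma ipZr (c : R) u w : ip u (c%:C%C *: w) = c * ip u w.
Proof. by rewrite ipC ipZl ipC. Qed.

Lemma ipBl u v w : ip (u - v) w = ip u w - ip v w.
Proof. by rewrite ipDl ipNl. Qed.

Lemma ipBr u v w : ip u (v - w) = ip u v - ip u w.
Proof. by rewrite ipDr ipNr. Qed.

Definition ipE := (ipBl, ipBr, ipDl, ipDr, ipNl, ipNr, ipZl, ipZr).

Lemma ip0l w : ip 0 w = 0.
Proof. by rewrite -(subrr w) ipBl subrr. Qed.

Lemma ip0r w : ip w 0 = 0.
Proof. by rewrite ipC ip0l. Qed.

Lemma ipvv v : ip v v = nrm v ^+ 2.
Proof. by rewrite /ip -hdot nrmE -rmorphXn. Qed.

Lemma ipvv_ge0 v : 0 <= ip v v.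
Proof. by rewrite ipvv sqr_ge0. Qed.

Lemma ipvv_eq0 v : ip v v = 0 -> v = 0.
Proof. by rewrite ipvv => /eqP; rewrite sqrf_eq0 => /eqP/nrm_eq0. Qed.

(** Cauchy-Schwarz, from the square of [|u| v - |v| u]. *)
Lemma ip_le u v : ip u v <= nrm u * nrm v.
Proof.
have nu := nrm_ge0 u; have nv := nrm_ge0 v.
have [u0|u0] := eqVneq (nrm u) 0.
  by rewrite (nrm_eq0 u0) ip0l nrm0 mul0r.
have {}u0 : 0 < nrm u by rewrite lt_def u0.
have [v0|v0] := eqVneq (nrm v) 0.
  by rewrite (nrm_eq0 v0) ip0r nrm0 mulr0.
have {}v0 : 0 < nrm v by rewrite lt_def v0.
have uv0 := mulr_gt0 u0 v0.
have := ipvv_ge0 ((nrm u)%:C%C *: v - (nrm v)%:C%C *: u).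
rewrite !(ipBl, ipBr, ipZl, ipZr) !ipvv (ipC v u).
move=> h; rewrite -(ler_pM2l uv0); nra.
Qed.

Lemma ip_norm_le u v : `|ip u v| <= nrm u * nrm v.
Proof.
rewrite ler_norml ip_le andbT lerNl -ipNl.
by rewrite -(nrmN u) ip_le.
Qed.

Lemma ip_eqP u v : (forall w, ip u w = ip v w) -> u = v.
Proof.
move=> h; apply/eqP; rewrite -subr_eq0; apply/eqP/ipvv_eq0.
by rewrite ipBl h subrr.
Qed.

Lemma adjoint_opP (a b : H -> H) : linear b ->
  (forall v w, ip (a v) w = ip v (b w)) -> adjoint_op dot a b.
Proof. by move=> lb h v w; rewrite !dotE h h linZ. Qed.

Lemma adjoint_ip (a b : H -> H) v w : adjoint_op dot a b -> ip (a v) w = ip v (b w).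
Proof. by move=> h; rewrite /ip h. Qed.

Lemma adjoint_sym (a b : H -> H) : adjoint_op dot a b -> adjoint_op dot b a.
Proof. by move=> h v w; rewrite dotC -h -dotC. Qed.

(** The Hilbert sum of two copies of H. The norm of the product type [H * H] is
a maximum, so it does not come from this form, but both define the same
topology. *)
Definition ip2 (p q : H * H) := ip p.1 q.1 + ip p.2 q.2.

Lemma ip2Dl p q r : ip2 (p + q) r = ip2 p r + ip2 q r.
Proof. by rewrite /ip2 !ipDl; lra. Qed.

Lemma ip2Bl p q r : ip2 (p - q) r = ip2 p r - ip2 q r.
Proof. by rewrite /ip2 !ipBl; lra. Qed.

Lemma ip2Br p q r : ip2 r (p - q) = ip2 r p - ip2 r q.
Proof. by rewrite /ip2 !ipBr; lra. Qed.

Lemma ip2C p q : ip2 p q = ip2 q p.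
Proof. by rewrite /ip2 ![ip p.1 _]ipC ![ip p.2 _]ipC. Qed.

Lemma ip2pp_eq0 p : ip2 p p = 0 -> p = 0.
Proof.
rewrite /ip2 => h; have := ipvv_ge0 p.1; have := ipvv_ge0 p.2 => h2 h1.
case: p h h1 h2 => a b /= h h1 h2.
have [-> ->] // : a = 0 /\ b = 0 by split; apply: ipvv_eq0; lra.
Qed.

Lemma ip2pp_ge0 p : 0 <= ip2 p p.
Proof. by rewrite addr_ge0 ?ipvv_ge0. Qed.

Let dist2 (K : set (H * H)) p := [set ip2 (p - k) (p - k) | k in K].

(** A minimizing sequence is Cauchy by the parallelogram law, and its limit
is the nearest point. The theorem is stated in [H * H] because it is mostly
applied to closed linear relations. *)
Theorem projection2 (K : set (H * H)) p : subsp K -> closed K ->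
  exists2 q, K q & forall k, K k -> ip2 (p - q) k = 0.
Proof.
move=> sK cK; have K0 := sK.1.
pose d := inf (dist2 K p).
have hinf : has_inf (dist2 K p).
  split; first by exists (ip2 (p - 0) (p - 0)), 0.
  by exists 0 => _ [k _ <-]; exact: ip2pp_ge0.
have d_le k : K k -> d <= ip2 (p - k) (p - k).
  by move=> Kk; apply: ge_inf; [exact: hinf.2|exists k].
have /choice[u hu] : forall n : nat, exists k, K k /\ ip2 (p - k) (p - k) < d + n.+1%:R^-1.
  move=> n; have /inf_adherent/(_ hinf)[_ [k Kk <-] h] : 0 < n.+1%:R^-1 :> R by [].
  by exists k.
have key k l (e : R) : K k -> K l -> ip2 (p - k) (p - k) <= d + e ->
    ip2 (p - l) (p - l) <= d + e -> ip2 (k - l) (k - l) <= 4 * e.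
  move=> Kk Kl hk hl; have Km : K ((2^-1)%:C%C *: (k + l)).
    by apply: subspZ => //; exact: subspD.
  have := d_le _ Km; move: hk hl; rewrite /ip2/=.
  rewrite !ipE.
  rewrite (ipC k.1 p.1) (ipC l.1 p.1) (ipC k.2 p.2) (ipC l.2 p.2).
  rewrite (ipC l.1 k.1) (ipC l.2 k.2); lra.
have small (e : R) : 0 < e -> exists n0 : nat, forall n, (n0 <= n)%N -> n.+1%:R^-1 < e.
  move=> e0; exists (truncn e^-1) => n hn.
  rewrite invf_plt ?posrE//; apply: lt_le_trans (truncnS_gt _) _.
  by rewrite ler_nat.
have cauchy (e : R) : 0 < e -> exists n0 : nat, forall m n, (n0 <= m)%N -> (n0 <= n)%N ->
    ip2 (u m - u n) (u m - u n) < e ^+ 2.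
  move=> e0; have [n0 h0] := small (e ^+ 2 / 4) (divr_gt0 (exprn_gt0 _ e0) (ltr0n _ 4)).
  exists n0 => m n hm hn; apply: le_lt_trans (key _ _ (Num.max m.+1%:R^-1 n.+1%:R^-1) _ _ _ _) _.
  - exact: (hu m).1.
  - exact: (hu n).1.
  - by apply: le_trans (ltW (hu m).2) _; rewrite lerD2l le_max lexx.
  - by apply: le_trans (ltW (hu n).2) _; rewrite lerD2l le_max lexx orbT.
  - rewrite mulrC -ltr_pdivlMr//.
    by rewrite gt_max !h0.
have sq_lt (v : H) (e : R) : 0 < e -> ip v v < e ^+ 2 -> nrm v < e.
  by move=> e0; rewrite ipvv ltr_pXn2r// nnegrE ?nrm_ge0// ltW.
have [l1 h1] : exists l, tends (fun n => (u n).1) l.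
  apply: complete_tends => e e0; have [n0 h0] := cauchy e e0.
  exists n0 => m n hm hn; apply: sq_lt => //; apply: le_lt_trans (h0 _ _ hm hn).
  by rewrite /ip2/= lerDl ipvv_ge0.
have [l2 h2] : exists l, tends (fun n => (u n).2) l.
  apply: complete_tends => e e0; have [n0 h0] := cauchy e e0.
  exists n0 => m n hm hn; apply: sq_lt => //; apply: le_lt_trans (h0 _ _ hm hn).
  by rewrite /ip2/= lerDr ipvv_ge0.
have ul : tends u (l1, l2).
  move=> e e0; have [n1 hn1] := h1 e e0; have [n2 hn2] := h2 e e0.
  exists (maxn n1 n2) => n; rewrite geq_max => /andP[/hn1 ? /hn2 ?].
  by rewrite nrm_pair/=; apply/andP.
have Kl : K (l1, l2) by apply: closed_tends ul => // n; exact: (hu n).1.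
exists (l1, l2) => // k Kk.
(* Comparing u n with its competitor u n + t k, which lies in K. *)
have quad n (t : R) : 0 <= n.+1%:R^-1 - 2 * t * ip2 (p - u n) k + t ^+ 2 * ip2 k k.
  have Ku : K (u n + t%:C%C *: k) by apply: subspD => //; [exact: (hu n).1|exact: subspZ].
  have := d_le _ Ku; have := (hu n).2; rewrite /ip2/=.
  rewrite !ipE.
  rewrite (ipC k.1 p.1) (ipC k.2 p.2) (ipC (u n).1 p.1) (ipC (u n).2 p.2).
  rewrite (ipC k.1 (u n).1) (ipC k.2 (u n).2) expr2.
  move: (n.+1%:R^-1) => e; lra.
have lim : forall e : R, 0 < e -> exists n0 : nat, forall n, (n0 <= n)%N ->
    `|ip2 (p - (l1, l2)) k - ip2 (p - u n) k| <= e.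
  move=> e e0; pose C := nrm k.1 + nrm k.2 + 1.
  have C0 : 0 < C by have := nrm_ge0 k.1; have := nrm_ge0 k.2; rewrite /C; lra.
  have [n0 h0] := ul (e / C) (divr_gt0 e0 C0).
  exists n0 => n /h0; rewrite nrm_pair/= => /andP[a1 a2].
  rewrite -ip2Bl (_ : _ - _ = u n - (l1, l2)); last by rewrite opprB addrC subrKA.
  rewrite /ip2/=.
  apply: le_trans (ler_normD _ _) _.
  apply: le_trans (lerD (ip_norm_le _ _) (ip_norm_le _ _)) _ => /=.
  have : nrm ((u n).1 - l1) * nrm k.1 <= (e / C) * nrm k.1.
    by rewrite ler_wpM2r ?nrm_ge0// ltW.
  have : nrm ((u n).2 - l2) * nrm k.2 <= (e / C) * nrm k.2.
    by rewrite ler_wpM2r ?nrm_ge0// ltW.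
  have : (e / C) * C = e by rewrite divfK// gt_eqF.
  have : 0 < e / C by exact: divr_gt0.
  rewrite /C; set X := e / _; nra.
have quadl (t : R) : 0 <= - 2 * t * ip2 (p - (l1, l2)) k + t ^+ 2 * ip2 k k.
  rewrite leNgt; apply/negP => neg.
  set A := ip2 (p - (l1, l2)) k in lim neg *; set B := _ * ip2 k k in neg.
  pose e := - (- 2 * t * A + B); have e0 : 0 < e by rewrite /e oppr_gt0.
  have T0 : 0 < 4 * (`|t| + 1) by have := normr_ge0 t; lra.
  have [n0 h0] := lim (e / (4 * (`|t| + 1))) (divr_gt0 e0 T0).
  have [n1 hn1] := small (e / 4) (divr_gt0 e0 (ltr0n _ 4)).
  have := h0 _ (leq_maxl n0 n1); have := hn1 _ (leq_maxr n0 n1).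
  have := quad (maxn n0 n1) t; rewrite -/B.
  set D := ip2 _ _; set s := _^-1 => q1 q2 q3.
  have : `|t * (A - D)| <= e / 4.
    rewrite normrM; apply: le_trans (ler_wpM2l (normr_ge0 t) q3) _.
    have := divr_gt0 e0 T0; have : e / (4 * (`|t| + 1)) * (4 * (`|t| + 1)) = e.
      by rewrite divfK// gt_eqF.
    have aux (T E x : R) : E * (4 * (T + 1)) = x -> 0 < E -> T * E <= x / 4.
      by move=> <- ?; lra.
    exact: aux.
  have eE : e = 2 * t * A - B by rewrite /e; ring.
  rewrite ler_norml => /andP[q4 q5]; clearbody e A B D s; clear -eE e0 q1 q2 q5.
  by lra.
set A := ip2 _ _ in quadl *; have kk := ip2pp_ge0 k.
apply/eqP/negPn/negP => A0.
(* The quadratic has its minimum at A / ip2 k k; adding 1 to the denominator keeps it nonzero. *)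
have := quadl (A / (ip2 k k + 1)); set D := ip2 k k + 1.
have D0 : 0 < D by rewrite /D; lra.
have : A = A / D * D by rewrite divfK// gt_eqF.
set X := A / D => AE.
have X0 : X != 0 by apply: contra_neq A0 => X0; rewrite AE X0 mul0r.
have := exprn_even_gt0 X (isT : ~~ odd 2); rewrite X0/= => X2.
rewrite AE; have -> : ip2 k k = D - 1 by rewrite /D addrK.
by nra.
Qed.

End InnerProduct.

(** * Adjoints, uniform boundedness and the closed graph theorem *)

Section Hilbert.
Context {R : realType} {H : completeNormedModType R[i]}.
Context (dot : {dot H for conjC}) (hdot : induces_norm dot).
Implicit Types (u v w : H) (a b : H -> H) (K : set H).
Local Notation ip := (reip dot).
Local Notation ip2 := (ip2 dot).

Lemma tends_op a (u : nat -> H) l :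
  bounded_op a -> tends u l -> tends (fun n => a (u n)) (a l).
Proof.
move=> ba ul; have [C C0 aC] := bounded_bound ba.
apply: (tends_dominated C0 ul) => n; by rewrite -linB ?aC//; exact: ba.1.
Qed.

Lemma tends_ip_le (u : nat -> H) l w (C : R) :
  tends u l -> (forall n, ip (u n) w <= C) -> ip l w <= C.
Proof.
move=> ul uC; rewrite -subr_le0; apply: (@small_le0 _ _ (nrm w)) => [|eps e0].
  exact: nrm_ge0.
have [n0 h] := ul _ e0; have {}h := h _ (leqnn _).
have := uC n0; have := ip_le hdot (l - u n0) w; rewrite ipBl nrmBC.
have := nrm_ge0 w; nra.
Qed.

Lemma tends_ip0 (u : nat -> H) l w :
  tends u l -> (forall n, ip (u n) w = 0) -> ip l w = 0.
Proof.
move=> ul h; apply/eqP; rewrite eq_le (tends_ip_le ul)/=; last by move=> n; rewrite h.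
rewrite -oppr_le0 -ipNr; apply: (tends_ip_le ul) => n.
by rewrite ipNr h oppr0.
Qed.

Lemma projection1 K v : subsp K -> closed K ->
  exists2 q, K q & forall k, K k -> ip (v - q) k = 0.
Proof.
move=> sK cK; pose K2 := [set p : H * H | K p.1 /\ p.2 = 0].
have sK2 : subsp K2.
  split; first by split; [exact: sK.1|].
  move=> c [v1 v2] [w1 w2] [/= h1 ->] [/= h2 ->]; split=> /=; first exact: sK.2.
  by rewrite scaler0 addr0.
have cK2 : closed K2.
  apply: closed_seq => u l Ku ul; split.
    by apply: closed_tends (tends_fst ul) => // n; exact: (Ku n).1.
  apply: (tends_unique (tends_snd ul)).
  by under eq_fun do rewrite (Ku _).2; exact: tends_cst.
have [[q1 q2] [/= Kq _] h] := projection2 hdot (v, 0) sK2 cK2.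
exists q1 => // k Kk; have := h (k, 0) (conj Kk erefl).
by rewrite /ip2/= ip0r addr0.
Qed.

Lemma subsp_full K : subsp K -> closed K ->
  (forall v, (forall k, K k -> ip v k = 0) -> v = 0) -> forall v, K v.
Proof.
move=> sK cK h v; have [q Kq /h/eqP] := projection1 v sK cK.
by rewrite subr_eq0 => /eqP ->.
Qed.

Lemma subsp_closure {V : normedModType R[i]} (K : set V) : subsp K -> subsp (closure K).
Proof.
move=> sK; split; first by apply: subset_closure; exact: sK.1.
move=> c v w /closure_seqP[u [Ku uv]] /closure_seqP[u' [Ku' uw]].
apply/closure_seqP; exists (fun n => c *: u n + u' n); split; last exact: tends_lin.
by move=> n; exact: sK.2.
Qed.

Lemma subsp_dense K : subsp K ->
  (forall v, (forall k, K k -> ip v k = 0) -> v = 0) -> forall v, closure K v.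
Proof.
move=> sK h; apply: subsp_full.
- exact: subsp_closure.
- exact: closed_closure.
- by move=> v vK; apply: h => k Kk; apply: vK; exact: subset_closure.
Qed.

Lemma dot_eq0 u v : ip u v = 0 -> ip u ('i%C *: v) = 0 -> dot u v = 0.
Proof. by move=> h h'; rewrite dotE h h'. Qed.

Lemma adjoint_linear a b : adjoint_op dot b a -> linear a.
Proof.
move=> /adjoint_sym h c u v; apply: (ip_eqP hdot) => w; congr complex.Re.
by rewrite dotDl dotZl !h dotDl linearZl_LR.
Qed.

(** Riesz representation of [v |-> dot (b v) w]: the representing vector is a
multiple of any nonzero vector orthogonal to the kernel of this functional. *)
Lemma adjoint_exists b : bounded_op b ->
  exists2 a, bounded_op a & adjoint_op dot b a.
Proof.
move=> bb; have [C C0 bC] := bounded_bound bb; have lb := bb.1.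
have /choice[a ha] : forall w, exists z, forall v, dot (b v) w = dot v z.
  move=> w; pose K := [set v | dot (b v) w = 0].
  have sK : subsp K.
    split; first by rewrite /K/= lin0// dot0l.
    by move=> c v v' Kv Kv'; rewrite /K/= lb dotDl dotZl Kv Kv' mulr0 addr0.
  have cK : closed K.
    apply: closed_seq => u l Ku ul; apply: dot_eq0.
      by apply: tends_ip0 (tends_op bb ul) _ => n; rewrite /reip Ku.
    by apply: tends_ip0 (tends_op bb ul) _ => n; rewrite /reip dotZr Ku mulr0.
  have [KT|/existsNP[v0 Kv0]] := pselect (forall v, K v).
    by exists 0 => v; rewrite linear0r; exact: KT.
  have [q Kq qK] := projection1 v0 sK cK.
  pose n := v0 - q.
  have nK k : K k -> dot k n = 0.
    move=> Kk; rewrite dotC dot_eq0 ?rmorph0//; first exact: qK.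
    by apply: qK; exact: subspZ.
  have bn : dot (b n) w != 0.
    apply/eqP; have Kq' : dot (b q) w = 0 := Kq.
    rewrite /n linB// dotBl Kq' subr0; exact: Kv0.
  have nn : dot n n != 0.
    apply: contra bn; rewrite -hdot sqrf_eq0 normr_eq0 => /eqP ->.
    by rewrite lin0// dot0l.
  exists ((dot (b n) w / dot n n)^*%C *: n) => v.
  rewrite dotZr conjcK.
  have : K (v - (dot (b v) w / dot (b n) w) *: n).
    rewrite /K/= linB// linZ// dotBl dotZl divfK//.
    exact: subrr.
  move=> /nK; rewrite dotBl dotZl => /eqP; rewrite subr_eq0 => /eqP ->.
  by rewrite mulrA mulrC mulrA; field; rewrite nn bn.
have la : linear a by apply: (@adjoint_linear _ b) => v w; exact: ha.
exists a; last by move=> v w; exact: ha.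
apply: (@bound_bounded _ _ _ C) => // v.
have [a0|a0] := eqVneq (nrm (a v)) 0; first by rewrite a0 mulr_ge0 ?nrm_ge0.
have {}a0 : 0 < nrm (a v) by rewrite lt_def a0 nrm_ge0.
rewrite -(ler_pM2l a0) -expr2 -(ipvv hdot).
have -> : ip (a v) (a v) = ip (b (a v)) v by rewrite /reip ha.
apply: le_trans (ip_le hdot _ _) _.
apply: le_trans (ler_wpM2r (nrm_ge0 _) (bC _)) _.
by rewrite mulrCA mulrA.
Qed.

(** Gliding hump: if the vectors [z n] of Z were unbounded, a convergent series
whose n-th term is a small multiple of [z n], with its sign chosen so that the
earlier terms cannot cancel it, would pair with the [z n] to an unbounded
sequence. *)
Lemma weakly_bounded (Z : set H) :
  (forall x, exists C : R, forall z, Z z -> `|ip x z| <= C) ->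
  exists2 C : R, 0 <= C & forall z, Z z -> nrm z <= C.
Proof.
move=> wb; apply: contrapT => unb.
have /choice[z hz] : forall n : nat, exists z, Z z /\ 2 * n.+1%:R * 4 ^+ n < nrm z.
  move=> n; apply: contrapT => no; apply: unb; exists (2 * n.+1%:R * 4 ^+ n).
    by rewrite !mulr_ge0// exprn_ge0.
  move=> z Zz; rewrite leNgt; apply/negP => zn; apply: no; by exists z.
pose s (n : nat) : R := 4 ^- n.
have s_gt0 n : 0 < s n by rewrite invr_gt0 exprn_gt0.
have sS n : s n.+1 = s n / 4 by rewrite /s exprS invfM mulrC.
have z_gt0 n : 0 < nrm (z n).
  by apply: le_lt_trans (hz n).2; rewrite !mulr_ge0// exprn_ge0.
(* The n-th term has norm s n - s n.+1, so the remaining terms sum to at most s n.+1 = s n / 4, a third of it. *)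
pose d n := (3 / 4 * s n / nrm (z n))%:C%C *: z n.
pose x := fix x n := if n is m.+1 then
  (if 0 <= ip (x m) (z m) then x m + d m else x m - d m) else 0.
have dz n : ip (d n) (z n) = 3 / 4 * s n * nrm (z n).
  by rewrite ipZl ipvv// expr2 mulrA divfK// gt_eqF.
have nd n : nrm (d n) = 3 / 4 * s n.
  rewrite nrmZ ger0_norm; first by rewrite divfK// gt_eqF.
  by rewrite divr_ge0 ?nrm_ge0//; have := s_gt0 n; lra.
have xz n : 3 / 4 * s n * nrm (z n) <= `|ip (x n.+1) (z n)|.
  rewrite -dz /=; case: ifPn => h; last rewrite -ltNge in h.
    by rewrite ipDl ger0_norm ?lerDr//; have := dz n; have := mulr_gt0 (s_gt0 n) (z_gt0 n); lra.
  rewrite ipBl ltr0_norm; first lra.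
  by have := dz n; have := mulr_gt0 (s_gt0 n) (z_gt0 n); lra.
have [l [_ xl]] : exists l, tends x l /\ forall n, nrm (l - x n) <= s n.
  apply: telescope_tends => [n|n|eps e0].
  - have -> : s n - s n.+1 = nrm (d n) by rewrite nd sS; lra.
    by rewrite /=; case: ifP => _; rewrite addrAC subrr add0r// nrmN.
  - exact: ltW.
  - have [n0 h] := half_small e0; exists n0; apply: le_lt_trans (h _ (leqnn _)).
    by rewrite lef_pV2 ?posrE ?exprn_gt0// lerXn2r// ?nnegrE; lra.
have [C hC] := wb l.
pose n := truncn C; have := hC _ (hz n).1.
have nC : C < n.+1%:R by exact: truncnS_gt.
have big : n.+1%:R < 2^-1 * s n * nrm (z n).
  have := (hz n).2; have : 4 ^+ n * s n = 1 by rewrite mulfV// gt_eqF// exprn_gt0.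
  have := s_gt0 n; have : 0 < 4 ^+ n :> R by rewrite exprn_gt0.
  have := z_gt0 n; move: (s n) (4 ^+ n) (nrm (z n)) (n.+1%:R : R) => S F N m N0 F0 S0 FS hN.
  have : S * (2 * m * F) < S * N by rewrite ltr_pM2l.
  have -> : S * (2 * m * F) = 2 * m by rewrite mulrC -[2 * m * F * S]mulrA FS mulr1.
  lra.
have : `|ip (l - x n.+1) (z n)| <= s n / 4 * nrm (z n).
  apply: le_trans (ip_norm_le hdot _ _) _; rewrite ler_wpM2r ?nrm_ge0//.
  by rewrite -sS xl.
have := xz n; have : `|ip (x n.+1) (z n)| <= `|ip l (z n)| + `|ip (l - x n.+1) (z n)|.
  by rewrite ipBl distrC -lerBlDl; apply: lerB_dist.
lra.
Qed.

(** The adjoint relation S of T is densely defined because T is closed. Its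
values at unit vectors are weakly bounded, since [ip v c = ip (a v) b]; the
resulting bound on S is a bound on [a]. *)
Lemma closed_graph (T : set (H * H)) : linear_graph T -> closed T ->
  (forall v, exists w, T (v, w)) ->
  exists2 a, bounded_op a & forall v w, T (v, w) <-> w = a v.
Proof.
move=> [T0 Tl T1] cT /choice[a Ta].
have aT v w : T (v, w) <-> w = a v.
  by split=> [/T1|->//]; apply.
have la : linear a by move=> c u v; apply/esym/aT; exact: Tl.
exists a => //.
pose S (c b : H) := forall v, dot c v = dot b (a v).
pose D := [set b | exists c, S c b].
have sT : subsp T by split=> // c [? ?] [? ?]; exact: Tl.
have sD : subsp D.
  split; first by exists 0 => v; rewrite !dot0l.
  move=> c b b' [d db] [d' db']; exists (c *: d + d') => v.
  by rewrite !dotDl !dotZl db db'.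
have dD : forall v, closure D v.
  apply: subsp_dense => // y yD.
  (* The component of (0, y) orthogonal to T is, up to a sign, a pair of S. *)
  have [[q1 q2] Tq qT] := projection2 hdot (0, y) sT cT.
  have h v : ip q1 v = ip (y - q2) (a v).
    have := qT _ (Ta v); rewrite /ip2/= sub0r ipNl; lra.
  have /yD : D (y - q2).
    exists q1 => v; rewrite !dotE h; congr (_ +i* _)%C.
    by rewrite h linZ.
  move: Tq => /aT q2E; have := h q1; rewrite -q2E ipBr ipBl => h1 h2.
  have h3 : ip (y - q2) (y - q2) = 0.
    have := ipvv_ge0 hdot (y - q2); have := ipvv_ge0 hdot q1.
    by rewrite !(ipBl, ipBr) (ipC _ q2 y) in h1 h2 *; lra.
  have yq : y = q2 by apply/eqP; rewrite -subr_eq0; apply/eqP/(ipvv_eq0 hdot).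
  have : ip q1 q1 = 0 by rewrite h1 -ipBl yq subrr ip0l.
  by move/(ipvv_eq0 hdot) => q10; rewrite yq q2E q10 lin0.
have [C C0 hC] : exists2 C : R, 0 <= C & forall z, (exists2 b, S z b & nrm b <= 1) -> nrm z <= C.
  apply: weakly_bounded => x; exists (nrm (a x)) => z [b Szb b1].
  have -> : ip x z = ip (a x) b by rewrite ipC (ipC _ _ b) /reip Szb.
  apply: le_trans (ip_norm_le hdot _ _) _.
  by rewrite -[leRHS]mulr1 ler_wpM2l ?nrm_ge0.
have SC (c b : H) : S c b -> nrm c <= C * nrm b.
  move=> Scb; have [b0|b0] := eqVneq (nrm b) 0.
    have c0 : c = 0.
      by apply: (ipvv_eq0 hdot); rewrite /reip Scb (nrm_eq0 b0) dot0l.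
    by rewrite c0 nrm0 mulr_ge0 ?nrm_ge0.
  have {}b0 : 0 < nrm b by rewrite lt_def b0 nrm_ge0.
  have : nrm (((nrm b)^-1)%:C%C *: c) <= C.
    apply: hC; exists (((nrm b)^-1)%:C%C *: b).
      by move=> v; rewrite !dotZl Scb.
    by rewrite nrmZ gtr0_norm ?invr_gt0// mulVf// gt_eqF.
  by rewrite nrmZ gtr0_norm ?invr_gt0// mulrC ler_pdivrMr.
apply: (@bound_bounded _ _ _ C) => // v.
have [a0|a0] := eqVneq (nrm (a v)) 0; first by rewrite a0 mulr_ge0 ?nrm_ge0.
have {}a0 : 0 < nrm (a v) by rewrite lt_def a0 nrm_ge0.
rewrite -(ler_pM2l a0) -subr_le0.
have Cv : 0 <= C * nrm v by rewrite mulr_ge0 ?nrm_ge0.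
apply: (@small_le0 _ _ (nrm (a v) + C * nrm v)) => [|eps e0]; first by lra.
have /closureP/(_ _ e0)[b [c Scb] bv] := dD (a v).
have h1 : ip (a v) (a v) = ip (a v) (a v - b) + ip v c.
  by rewrite ipBr [ip v c]ipC [in RHS](ipC _ _ b) /reip Scb subrK.
have h2 := ip_le hdot (a v) (a v - b); have h3 := ip_le hdot v c.
have h4 : nrm v * nrm c <= nrm v * (C * nrm b) by rewrite ler_wpM2l ?nrm_ge0// SC.
have h5 : nrm b <= nrm (a v) + eps.
  have := nrm_dist b (a v) 0; rewrite !subr0 nrmBC; lra.
have h6 : C * nrm v * nrm b <= C * nrm v * (nrm (a v) + eps) by rewrite ler_wpM2l.
have h7 : nrm (a v) * nrm (a v - b) <= nrm (a v) * eps by rewrite ler_pM2l// ltW.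
move: h1; rewrite ipvv// expr2; nra.
Qed.

End Hilbert.

(** * Projections onto closed linear relations *)

Section OrthogonalProjections.
Context {R : realType} {H : completeNormedModType R[i]}.
Context (dot : {dot H for conjC}) (hdot : induces_norm dot).
Implicit Types (u v w : H) (a b h : H -> H) (x : set (H * H)).
Local Notation ip := (reip dot).
Local Notation ip2 := (ip2 dot).

Definition stable b x := forall v w, x (v, w) -> x (b v, b w).

Lemma ip2_orth_scale x c (p : H * H) : subsp x ->
  (forall k, x k -> ip2 p k = 0) -> forall k, x k -> ip2 (c *: p) k = 0.
Proof.
move=> sx px k xk; have := px k xk; have := px _ (subspZ 'i%C sx xk).
rewrite /ip2/= (re_im_scale c p.1) (re_im_scale c p.2) !(ipDl, ipZl, ipJ) => h1 h2.
transitivity (complex.Re c * (ip p.1 k.1 + ip p.2 k.2)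
  - complex.Im c * (ip p.1 ('i%C *: k.1) + ip p.2 ('i%C *: k.2))); first by ring.
by rewrite h1 h2; ring.
Qed.

(** Uniqueness is the source of all algebraic properties of projections below:
linearity, symmetry and commutation. *)
Lemma proj_unique x p q r : subsp x -> x q -> x r ->
  (forall k, x k -> ip2 (p - q) k = 0) -> (forall k, x k -> ip2 (p - r) k = 0) ->
  q = r.
Proof.
move=> sx xq xr hq hr; apply/eqP; rewrite -subr_eq0; apply/eqP/(ip2pp_eq0 hdot).
have xqr : x (q - r) by exact: subspB.
have -> : ip2 (q - r) (q - r) = ip2 ((p - r) - (p - q)) (q - r).
  by congr (ip2 _ _); rewrite opprB [RHS]addrC subrKA.
by rewrite ip2Bl hq// hr// subrr.
Qed.

(** For x the graph of a closed densely defined operator T, [B] is the inverse of [1 + T^* T] and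
[C = T B]. They are the two components of the projection onto x restricted to
the first summand, so they are contractions and commute with every operator
that preserves x and whose adjoint preserves x. *)
Lemma graph_projection x : subsp x -> closed x ->
  exists B C, [/\ bounded_op B, bounded_op C, forall u, x (B u, C u),
    forall u v w, x (v, w) -> ip (u - B u) v = ip (C u) w
  & forall b b', linear b -> adjoint_op dot b b' -> stable b x -> stable b' x ->
      forall u, B (b u) = b (B u) /\ C (b u) = b (C u)].
Proof.
move=> sx cx.
have /choice[P hP] : forall u, exists q, x q /\ forall k, x k -> ip2 ((u, 0) - q) k = 0.
  by move=> u; have [q ? ?] := projection2 hdot (u, 0) sx cx; exists q.
have lP c u v : P (c *: u + v) = c *: P u + P v.
  apply: (@proj_unique x (c *: u + v, 0)) => //; first exact: (hP _).1.
  - by apply: sx.2; exact: (hP _).1.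
  - exact: (hP _).2.
  - move=> k xk; have -> : (c *: u + v, 0) - (c *: P u + P v) =
        c *: ((u, 0) - P u) + ((v, 0) - P v).
      by rewrite scalerBr addrACA opprD; congr (_ + _); congr pair => /=;
        rewrite scaler0 addr0.
    rewrite ip2Dl (ip2_orth_scale _ sx (hP u).2)// (hP v).2// addr0.
    by [].
have nP u : ip2 (P u) (P u) <= ip u u.
  have := (hP u).2 _ (hP u).1; have := ip2pp_ge0 hdot ((u, 0) - P u).
  rewrite !(ip2Bl, ip2Br) (ip2C _ (P u) (u, 0)) => h1 h2.
  have : ip2 (u, 0) (u, 0) = ip u u by rewrite /ip2/= ip0l addr0.
  lra.
have nB (f : H * H -> H) : (forall p, ip (f p) (f p) <= ip2 p p) ->
    forall u, nrm (f (P u)) <= 1 * nrm u.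
  move=> hf u; rewrite mul1r -(@ler_pXn2r _ 2) ?nnegrE ?nrm_ge0//.
  by rewrite -!(ipvv hdot); apply: le_trans (nP u); exact: hf.
exists (fun u => (P u).1), (fun u => (P u).2); split.
- apply: (@bound_bounded _ _ _ 1) => [c u v|]; first by rewrite lP.
  by apply: nB => p; rewrite /ip2 lerDl ipvv_ge0.
- apply: (@bound_bounded _ _ _ 1) => [c u v|]; first by rewrite lP.
  by apply: nB => p; rewrite /ip2 lerDr ipvv_ge0.
- by move=> u; have := (hP u).1; case: (P u).
- move=> u v w xvw; have := (hP u).2 _ xvw; rewrite /ip2/= sub0r ipNl; lra.
- move=> b b' lb bb' xb xb' u.
  suff -> : P (b u) = (b (P u).1, b (P u).2) by [].
  apply: (@proj_unique x (b u, 0)) => //; first exact: (hP _).1.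
  + by apply: xb; have := (hP u).1; case: (P u).
  + exact: (hP _).2.
  + move=> [k1 k2] xk; have := (hP u).2 _ (xb' _ _ xk).
    by rewrite /ip2/= !sub0r !ipNl -linB// !(adjoint_ip _ _ bb').
Qed.

Lemma closed_op_graph b : bounded_op b -> closed (op_graph b).
Proof.
move=> bb; apply: closed_seq => u l gu ul; apply: (tends_unique (tends_snd ul)).
by under eq_fun do rewrite gu; apply: tends_op => //; exact: tends_fst.
Qed.

Lemma subsp_op_graph b : linear b -> subsp (op_graph b).
Proof.
move=> lb; split; first by rewrite /op_graph/= lin0.
by move=> c [v1 v2] [w1 w2]; rewrite /op_graph/= lb => -> ->.
Qed.

End OrthogonalProjections.

(** * The commutant and the projections of the algebra *)

Section Commutant.
Context {R : realType} {H : completeNormedModType R[i]}.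
Context (dot : {dot H for conjC}) (hdot : induces_norm dot).
Context (M : set (H -> H)) (hM : von_neumann_algebra dot M).
Implicit Types (u v w : H) (a b h : H -> H) (x : set (H * H)).
Local Notation ip := (reip dot).
Local Notation M' := (commutant M).

Lemma M_bd a : M a -> bounded_op a.
Proof. exact: (vna_bounded hM). Qed.

Lemma M_lin a : M a -> linear a.
Proof. by move/M_bd => []. Qed.

Lemma comm_bd b : M' b -> bounded_op b.
Proof. by case. Qed.

Lemma comm_lin b : M' b -> linear b.
Proof. by move/comm_bd => []. Qed.

Lemma comm_swap a b v : M a -> M' b -> a (b v) = b (a v).
Proof. by move=> Ma [_ /(_ _ Ma)]; move/(congr1 (fun f => f v)). Qed.

Lemma bd_lin c a b : bounded_op a -> bounded_op b ->
  bounded_op (fun v => c *: a v + b v).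
Proof.
move=> ba bb; have [Ca _ hCa] := bounded_bound ba; have [Cb _ hCb] := bounded_bound bb.
apply: (@bound_bounded _ _ _ (complex.Re `|c| * Ca + Cb)) => [d u v|v].
  rewrite ba.1 bb.1 !scalerDr !scalerA (mulrC c d) -!addrA; congr (_ + _).
  by rewrite addrCA.
apply: le_trans (nrmD _ _) _; rewrite nrmZC mulrDl lerD// -mulrA ler_wpM2l//.
by have := normr_ge0 c; rewrite -{1}(@RRe_real _ `|c|) ?normr_real// ler0c.
Qed.

Lemma bd_comp a b : bounded_op a -> bounded_op b -> bounded_op (a \o b).
Proof.
move=> [la ca] [lb cb]; split; first by move=> c u v /=; rewrite lb la.
by move=> v; apply: continuous_comp; [exact: cb|exact: ca].
Qed.

Lemma bd_id : bounded_op (id : H -> H).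
Proof. by split=> // v; exact: cvg_id. Qed.

Lemma M_intro a : bounded_op a ->
  (forall b, M' b -> forall v, b (a v) = a (b v)) -> M a.
Proof.
move=> ba h; rewrite -(vna_bicommutant hM); split=> // b M'b.
by apply/funext => v /=; exact: h.
Qed.

Lemma comm_intro b : bounded_op b ->
  (forall a, M a -> forall v, a (b v) = b (a v)) -> M' b.
Proof. by move=> bb h; split=> // a Ma; apply/funext => v /=; exact: h. Qed.

Lemma comm_comb c a b : M' a -> M' b -> M' (fun v => c *: a v + b v).
Proof.
move=> Ma Mb; apply: comm_intro => [|d Md v].
  by apply: bd_lin; exact: comm_bd.
by rewrite (M_lin Md) (comm_swap v Md Ma) (comm_swap v Md Mb).
Qed.

Lemma comm_id : M' id.
Proof. by apply: comm_intro => //; exact: bd_id. Qed.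

Lemma comm_adjoint b : M' b -> exists2 b', M' b' & adjoint_op dot b b'.
Proof.
move=> Mb; have [b' bdb' bb'] := adjoint_exists hdot (comm_bd Mb).
exists b' => //; apply: comm_intro => // a Ma v.
have [a' Ma' aa'] := vna_adj hM Ma.
apply: (ip_eqP hdot) => w.
rewrite (adjoint_ip _ _ aa') (adjoint_ip _ _ (adjoint_sym bb')).
rewrite -(comm_swap _ Ma' Mb) -(adjoint_ip _ _ aa').
by rewrite -(adjoint_ip _ _ (adjoint_sym bb')).
Qed.

Lemma M_comb c a b : M a -> M b -> M (fun v => c *: a v + b v).
Proof. exact: (vna_lin hM). Qed.

Lemma M_comp a b : M a -> M b -> M (fun v => a (b v)).
Proof. exact: (vna_mul hM). Qed.

Lemma M_id : M id.
Proof. exact: (vna_one hM). Qed.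

Lemma M_add a b : M a -> M b -> M (fun v => a v + b v).
Proof. by move=> Ma /(M_comb 1 Ma); under eq_fun do rewrite scale1r. Qed.

Lemma M_zero : M (fun=> 0).
Proof.
have := M_comb (- 1) M_id M_id.
by under eq_fun do rewrite scaleN1r addNr.
Qed.

Lemma M_scale c a : M a -> M (fun v => c *: a v).
Proof. by move=> Ma; have := M_comb c Ma M_zero; under eq_fun do rewrite addr0. Qed.

Lemma M_sub a b : M a -> M b -> M (fun v => a v - b v).
Proof.
by move=> Ma /(M_comb (- 1))/(_ Ma); under eq_fun do rewrite scaleN1r addrC.
Qed.

(** The unitary is the Cayley transform [(t h - i) / (t h + i)], with adjoint
[U']. With [B] the inverse of [1 + t^2 h^2] and [C = t h B], both components of
the projection onto the graph of [t h], it equals [1 - 2 B - 2 i C]. The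
difference [U' - U] recovers [h B], and [B] tends to 1 as t tends to 0. *)
Lemma cayley h (t : R) : M' h -> adjoint_op dot h h -> exists B U U',
  [/\ M' U, adjoint_op dot U U', U \o U' = id, U' \o U = id &
   (forall v, U' v - U v = 4%:C%C *: ('i%C *: (t%:C%C *: h (B v)))) /\
   forall v, v - B v = t%:C%C *: h (t%:C%C *: h (B v)) /\ nrm (B v) <= nrm v].
Proof.
move=> Mh hh; have lh := comm_lin Mh.
pose g v := t%:C%C *: h v.
have Mg : M' g.
  by have := comm_comb t%:C%C Mh (comm_comb (- 1) comm_id comm_id);
    under eq_fun do rewrite scaleN1r addNr addr0.
have lg := comm_lin Mg.
have gE v w : ip (g v) w = ip v (g w).
  by rewrite ipZl ipZr (adjoint_ip _ _ hh).
have gg : adjoint_op dot g g by exact: adjoint_opP.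
have [B [C [bB bC BC orth comm]]] :=
  graph_projection hdot (subsp_op_graph lg) (closed_op_graph (comm_bd Mg)).
have CB v : C v = g (B v) by exact: BC.
have lB := bB.1; have lC := bC.1.
have res v : v - B v = g (C v).
  by apply: (ip_eqP hdot) => w; rewrite (orth _ w (g w))// gE.
have Bg v : B (g v) = g (B v).
  apply: (proj1 (comm g g lg gg _ _ v)) => u w; rewrite /op_graph/= => -> //.
have st c : M c -> stable c (op_graph g).
  by move=> Mc u w; rewrite /op_graph/= => ->; rewrite (comm_swap _ Mc Mg).
have MB : M' B.
  apply: comm_intro => // a Ma v; have [a' Ma' aa'] := vna_adj hM Ma.
  by have [->] := comm a a' (M_lin Ma) aa' (st _ Ma) (st _ Ma') v.
have sB v w : ip (B v) w = ip v (B w).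
  have E u u' : ip u (B u') = ip (B u) (B u') + ip (C u) (C u').
    by have := orth u _ _ (BC u'); rewrite ipBl; lra.
  by rewrite [LHS]ipC (E w v) (E v w) (ipC _ (B w)) (ipC _ (C w)).
have sC v w : ip (C v) w = ip v (C w).
  by rewrite !CB gE sB Bg.
have CC v : C (C v) = B v - B (B v).
  by rewrite CB -Bg -res linB.
have BC_comm v : C (B v) = B (C v) by rewrite !CB Bg.
pose two : R := 2.
(* U 1 is the transform and U (-1) its adjoint. *)
pose U s v := v - two%:C%C *: B v - (s * two)%:C%C *: ('i%C *: C v).
have lU s : linear (U s).
  move=> c u v; rewrite /U lB lC; apply: (ip_eqP hdot) => w.
  rewrite (re_im_scale c u) (re_im_scale c (B u)) (re_im_scale c (C u)).
  rewrite (re_im_scale c (u - _ - _)).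
  by rewrite !(scalerDr, scalerN, ipE, ipJ, ipNr); ring.
have MC : M' C.
  have -> : C = g \o B by apply/funext.
  by apply: comm_intro => [|a Ma v]; [exact: bd_comp (comm_bd Mg) bB|
    rewrite /= (comm_swap _ Ma Mg) (comm_swap _ Ma MB)].
have MU s : M' (U s).
  have -> : U s = fun v => (- (s * two)%:C%C * 'i%C) *: C v +
      ((- two%:C%C) *: B v + id v).
    apply/funext => v; rewrite /U -scalerA !scaleNr [in RHS]addrC; congr (_ - _).
    by rewrite addrC.
  by apply: comm_comb => //; apply: comm_comb => //; exact: comm_id.
have UU s v : s ^+ 2 = 1 -> U (- s) (U s v) = v.
  move=> s1; apply: (ip_eqP hdot) => w; rewrite /U.
  rewrite !(linB _ _ lB, linB _ _ lC, linZ _ _ lB, linZ _ _ lC) CC BC_comm.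
  rewrite !(scalerDr, scalerN, ipE, ipJ, ipNr) mulNr.
  have -> : 'i%C *: ('i%C *: w) = - w by rewrite scalerA -expr2 sqr_i scaleN1r.
  by rewrite !ipE /two; ring: s1.
have adj s : adjoint_op dot (U s) (U (- s)).
  apply: adjoint_opP => // v w.
  rewrite /U !(ipE, ipJ, ipNr) sB sC.
  by rewrite (linZ _ _ lC); ring.
exists B, (U 1), (U (- 1)); split.
- exact: MU.
- exact: adj.
- by apply/funext => v /=; have := UU (- 1) v; rewrite opprK; apply; rewrite sqrrN expr1n.
- by apply/funext => v /=; rewrite UU// expr1n.
- split=> v.
    apply: (ip_eqP hdot) => w; rewrite /U/two -/(g (B v)) -CB.
    by rewrite !(ipE, ipJ, ipNr); ring.
  split; first by rewrite res CB.
  have [Bv0|Bv0] := eqVneq (nrm (B v)) 0; first by rewrite Bv0 nrm_ge0.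
  have {}Bv0 : 0 < nrm (B v) by rewrite lt_def Bv0 nrm_ge0.
  rewrite -(ler_pM2r Bv0) -expr2 -(ipvv hdot); apply: le_trans (ip_le hdot _ _).
  by rewrite -subr_ge0 -ipBl (orth _ _ _ (BC v)) ipvv_ge0.
Qed.

(** A linear relation invariant under unitaries is invariant under the
combinations [h B] of Cayley transforms, hence, being closed, under their limit
[h]. The real and imaginary parts of an element of the commutant give the
rest. *)
Lemma affiliated_stable x : subsp x -> closed x -> affiliated dot M x ->
  forall b, M' b -> stable b x.
Proof.
move=> sx cx ax.
have sa h : M' h -> adjoint_op dot h h -> stable h x.
  move=> Mh hh v w xvw; have [c c0 hc] := bounded_bound (comm_bd Mh).
  have lh := comm_lin Mh.
  have /choice[B hB] : forall n : nat, exists B,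
      x (h (B v), h (B w)) /\ forall u, nrm (h (B u) - h u) <= c * c * c * nrm u * 2 ^- n.
    move=> n; pose t : R := 2 ^- n.
    have t0 : 0 < t by rewrite invr_gt0 exprn_gt0.
    have t1 : t <= 1 by rewrite invf_le1 ?exprn_gt0// exprn_ege1// ler1n.
    (* h B_t differs from h by t^2 h^3 B_t, which is of the order of t^2, hence of t = 2^-n. *)
    have [B [U [U' [MU UU' UU1 UU2 [UB resB]]]]] := cayley t Mh hh.
    have uU : unitary_op dot U.
      by split; [exact: comm_bd|exists U'].
    have xU : x (U v, U w) by exact: (proj1 (ax U MU uU v w)).
    have xU' : x (U' v, U' w).
      apply: (proj2 (ax U MU uU _ _)).
      by rewrite -[U (U' v)]/((U \o U') v) -[U (U' w)]/((U \o U') w) UU1.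
    exists B; split.
      have k0 : (4%:C * 'i * t%:C)%C != 0 :> R[i].
        by rewrite !mulf_neq0//; apply/eqP => -[] /eqP; rewrite ?oner_eq0 ?pnatr_eq0 ?gt_eqF.
      have : x ((4%:C * 'i * t%:C)%C^-1 *: (U' v - U v, U' w - U w)).
        by apply: subspZ => //; apply: (subspB sx xU' xU).
      rewrite !UB !scalerA.
      rewrite (_ : _ *: _ = (h (B v), h (B w)))//.
      by congr pair => /=; rewrite scalerA mulVf// scale1r.
    move=> u; have [rB nB] := resB u.
    rewrite nrmBC -linB// rB.
    apply: le_trans (hc _) _; rewrite nrmZ gtr0_norm// (linZ _ _ lh) nrmZ gtr0_norm//.
    have := hc (h (B u)); have := hc (B u); have := nrm_ge0 u; rewrite -/t.
    move: (nrm (h (h _))) (nrm (h (B u))) (nrm (B u)) (nrm u) nB => p q r s rs s0 qr pq.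
    have pcs : p <= c * c * s.
      apply: le_trans pq _; rewrite -mulrA ler_wpM2l//; apply: le_trans qr _.
      by rewrite ler_wpM2l.
    have : t * (t * p) <= t * (1 * (c * c * s)).
      have p0 : 0 <= c * c * s by rewrite !mulr_ge0.
      by rewrite ler_pM2l//; nra.
    by move=> /(ler_wpM2l c0); nra.
  apply: (@closed_tends _ _ _ (fun n => (h (B n v), h (B n w)))) => //.
    by move=> n; exact: (hB n).1.
  have lim u : tends (fun n => h (B n u)) (h u).
    apply: tends_dominated half_small _ => [|n]; last exact: (hB n).2.
    by rewrite !mulr_ge0// nrm_ge0.
  by apply: tends_pair; exact: lim.
move=> b Mb v w xvw.
have [b' Mb' bb'] := comm_adjoint Mb.
have lb := comm_lin Mb; have lb' := comm_lin Mb'.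
have eb u u' : ip (b u) u' = ip u (b' u') by exact: adjoint_ip.
have eb' u u' : ip (b' u) u' = ip u (b u') by exact: adjoint_ip (adjoint_sym bb').
have x1 : stable (fun v => b v + b' v) x.
  have M1 : M' (fun v => b v + b' v).
    by have := comm_comb 1 Mb Mb'; under eq_fun do rewrite scale1r.
  apply: sa => //; apply: adjoint_opP (comm_lin M1) _ => u u'.
  by rewrite ipDl eb eb' ipDr addrC.
have x2 : stable (fun v => 'i%C *: (b v - b' v)) x.
  have M2 : M' (fun v => 'i%C *: (b v - b' v)).
    have := comm_comb 'i%C Mb (comm_comb (- 'i%C - 1) Mb' Mb').
    by under eq_fun do rewrite scalerBl scale1r subrK scaleNr -scalerBr.
  apply: sa => //; apply: adjoint_opP (comm_lin M2) _ => u u'.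
  by rewrite ipJ ipBl eb eb' (linZ _ _ lb) (linZ _ _ lb') scalerBr ipBr; lra.
have := subspZ (2^-1)%:C%C sx
  (subspB sx (x1 _ _ xvw) (subspZ 'i%C sx (x2 _ _ xvw))).
rewrite (_ : _ *: _ = (b v, b w))//.
have E u : (2^-1)%:C%C *: (b u + b' u - 'i%C *: ('i%C *: (b u - b' u))) = b u.
  apply: (ip_eqP hdot) => z; rewrite [in X in _ - X]scalerA -expr2 sqr_i scaleN1r.
  by rewrite !ipE; lra.
by congr pair => /=; exact: E.
Qed.

Definition is_proj e := projections dot M e.

Lemma proj_lin e : is_proj e -> linear e.
Proof. by case=> /M_lin. Qed.

Lemma proj_idem e v : is_proj e -> e (e v) = e v.
Proof. by case=> _ _ /(congr1 (fun f => f v)). Qed.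

Lemma proj_sym e v w : is_proj e -> ip (e v) w = ip v (e w).
Proof. by case=> _ /adjoint_ip. Qed.

Lemma proj_contr e v : is_proj e -> nrm (e v) <= nrm v.
Proof.
move=> pe; have [e0|e0] := eqVneq (nrm (e v)) 0; first by rewrite e0 nrm_ge0.
have {}e0 : 0 < nrm (e v) by rewrite lt_def e0 nrm_ge0.
rewrite -(ler_pM2r e0) -expr2 -(ipvv hdot) proj_sym// proj_idem//.
exact: ip_le.
Qed.

Lemma perp_proj e : is_proj e -> is_proj (perp e).
Proof.
move=> pe; have le := proj_lin pe; split.
- by apply: M_sub; [exact: M_id|case: pe].
- apply: adjoint_opP => [|v w]; first by move=> c u v; rewrite /perp le scalerBr opprD addrACA.
  by rewrite /perp ipBl ipBr proj_sym.
- by apply/funext => v; rewrite /= /perp (linB _ _ le) (proj_idem _ pe) subrr subr0.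
Qed.

Lemma perpE e v : is_proj e -> perp e v = 0 <-> e v = v.
Proof.
by move=> pe; rewrite /perp; split=> [/eqP|->]; rewrite ?subrr// subr_eq0 => /eqP.
Qed.

(** The projection onto K commutes with every b in the commutant, because K is
invariant under both b and its adjoint. *)
Lemma proj_of K : subsp K -> closed K ->
  (forall b, M' b -> forall v, K v -> K (b v)) ->
  exists2 e, is_proj e & forall v, e v = v <-> K v.
Proof.
move=> sK cK iK; pose x := [set p : H * H | K p.1 /\ p.2 = 0].
have sx : subsp x.
  split; first by split; [exact: sK.1|].
  move=> c [v1 v2] [w1 w2] [/= h1 ->] [/= h2 ->]; split=> /=; first exact: sK.2.
  by rewrite scaler0 addr0.
have cx : closed x.
  apply: closed_seq => u l Ku ul; split.
    by apply: closed_tends (tends_fst ul) => // n; exact: (Ku n).1.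
  apply: (tends_unique (tends_snd ul)).
  by under eq_fun do rewrite (Ku _).2; exact: tends_cst.
have ix b : M' b -> stable b x.
  move=> Mb v w [/= Kv ->]; split; first exact: iK.
  by rewrite /= lin0//; exact: comm_lin.
have [B [C [bB bC BC orth comm]]] := graph_projection hdot sx cx.
have KB u : K (B u) by exact: (BC u).1.
have C0 u : C u = 0 by exact: (BC u).2.
have o u k : K k -> ip (u - B u) k = 0.
  by move=> Kk; rewrite (orth u k 0)// ip0r.
have BK v : B v = v <-> K v.
  split=> [<-//|Kv]; apply/eqP; rewrite eq_sym -subr_eq0; apply/eqP/(ipvv_eq0 hdot).
  by apply: o; exact: subspB.
exists B => //; split.
- apply: M_intro => // b Mb v; have [b' Mb' bb'] := comm_adjoint Mb.
  by have [->] := comm b b' (comm_lin Mb) bb' (ix _ Mb) (ix _ Mb') v.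
- apply: adjoint_opP => [|v w]; first exact: bB.1.
  have h1 := o v (B w) (KB w); have h2 := o w (B v) (KB v).
  by rewrite !ipBl in h1 h2; rewrite (ipC _ (B v)); rewrite (ipC _ (B w)) in h2 *; lra.
- by apply/funext => v /=; apply/BK.
Qed.

Lemma ker_proj a : M a -> exists2 g, is_proj g & forall v, g v = v <-> a v = 0.
Proof.
move=> Ma; have la := M_lin Ma; apply: proj_of.
- split; first exact: lin0.
  by move=> c v w /= av aw; rewrite la av aw scaler0 addr0.
- apply: closed_seq => u l au ul; apply: (tends_unique (tends_op (M_bd Ma) ul)).
  by under eq_fun do rewrite au; exact: tends_cst.
- by move=> b Mb v /= av; rewrite (comm_swap _ Ma Mb) av lin0//; exact: comm_lin.
Qed.

Lemma cap_proj (I : Type) (e : I -> H -> H) : (forall i, is_proj (e i)) ->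
  exists2 g, is_proj g & forall v, g v = v <-> forall i, e i v = v.
Proof.
move=> pe; apply: proj_of.
- split=> [i|c v w h1 h2 i]; first by rewrite lin0//; exact: proj_lin.
  by rewrite proj_lin// h1 h2.
- apply: closed_seq => u l h ul i; apply: (tends_unique _ ul).
  have := tends_op (M_bd (proj1 (let: And3 x y z := pe i in conj x y))) ul.
  by under eq_fun do rewrite h.
- by move=> b Mb v h i; rewrite comm_swap// ?h//; case: (pe i).
Qed.

End Commutant.

(** * The trace on projections *)

Section Trace.
Context {R : realType} {H : completeNormedModType R[i]}.
Context (dot : {dot H for conjC}) (hdot : induces_norm dot).
Context (M : set (H -> H)) (hM : von_neumann_algebra dot M).
Context (tau : (H -> H) -> \bar R) (htau : fns_trace dot M tau).
Implicit Types (u v w : H) (a b e f g h p q : H -> H) (K : set H).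
Local Notation ip := (reip dot).
Local Notation M' := (commutant M).
Local Notation is_proj := (is_proj dot M).
Local Notation pos := (positive_part dot M).

Lemma pos_dot a v : pos a -> dot (a v) v = (ip (a v) v)%:C%C /\ 0 <= ip (a v) v.
Proof.
move=> [_ /(_ v)]; rewrite subr0 => a0; split; last first.
  by move: a0; rewrite lecE => /andP[].
by rewrite /reip RRe_real// ger0_real.
Qed.

Lemma pos_ge0 a v : pos a -> 0 <= ip (a v) v.
Proof. by move=> /(pos_dot v)[]. Qed.

Lemma pos_M a : pos a -> M a.
Proof. by case. Qed.

Lemma pos_intro a : M a -> (forall v w, ip (a v) w = ip v (a w)) ->
  (forall v, 0 <= ip (a v) v) -> pos a.
Proof.
move=> Ma sa a0; split=> // v; rewrite subr0 dotE lecE /= a0 andbT.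
apply/eqP; have := sa v ('i%C *: v).
rewrite (linZ _ _ (M_lin hM Ma)) [in RHS]ipC ipJ; lra.
Qed.

Lemma op_leP a b : pos a -> pos b ->
  op_le dot a b <-> forall v, ip (a v) v <= ip (b v) v.
Proof.
move=> pa pb; split=> h v; have [ha _] := pos_dot v pa; have [hb _] := pos_dot v pb.
  by have := h v; rewrite dotBl ha hb -rmorphB/= ler0c subr_ge0.
by rewrite dotBl ha hb -rmorphB/= ler0c subr_ge0.
Qed.

Lemma pos_add a b : pos a -> pos b -> pos (fun v => a v + b v).
Proof.
move=> pa pb; split=> [|v]; first by apply: (M_add hM); exact: pos_M.
by rewrite subr0 dotDl addr_ge0// (pos_dot _ _).1// ler0c pos_ge0.
Qed.

Lemma tau_mono a b : pos a -> pos b -> (forall v, ip (a v) v <= ip (b v) v) ->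
  (tau a <= tau b)%E.
Proof.
move=> pa pb ab; have pc : pos (fun v => b v - a v).
  split=> [|v]; first by apply: (M_sub hM); exact: pos_M.
  by rewrite subr0; apply: (proj2 (op_leP pa pb)).
have -> : b = fun v => a v + (b v - a v) by apply/funext => v; rewrite addrC subrK.
by rewrite (tr_add htau)// leeDl// (tr_ge0 htau).
Qed.

Lemma pos_square a b : M a -> adjoint_op dot a b -> M b -> pos (fun v => b (a v)).
Proof.
move=> Ma ab Mb; have ba := adjoint_sym ab.
apply: pos_intro => [|v w|v]; first exact: (M_comp hM).
  by rewrite (adjoint_ip _ _ ba) (adjoint_ip _ _ ab).
by rewrite (adjoint_ip _ _ ba) ipvv_ge0.
Qed.

Lemma pos_proj e : is_proj e -> pos e.
Proof.
move=> pe; apply: pos_intro; first by case: pe.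
  by move=> v w; apply: (proj_sym (M := M)).
by move=> v; rewrite -(proj_idem _ pe) (proj_sym _ _ pe) ipvv_ge0.
Qed.

Lemma proj_ip e v : is_proj e -> ip (e v) v = nrm (e v) ^+ 2.
Proof.
move=> pe; rewrite -(ipvv hdot) [RHS](proj_sym _ _ pe) (proj_idem _ pe).
exact: (proj_sym _ _ pe).
Qed.

Lemma proj_ip_mono p q v : is_proj p -> is_proj q -> (forall v, p v = v -> q v = v) ->
  ip (p v) v <= ip (q v) v.
Proof.
move=> pp pq h; have pE : ip (p v) v = ip (p v) (q v).
  by rewrite -(proj_sym _ _ pq) (h (p v))// (proj_idem _ pp).
have := ip_le hdot (p v) (q v); rewrite -pE (proj_ip _ pp) (proj_ip _ pq).
have := nrm_ge0 (p v); have := nrm_ge0 (q v).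
by move: (nrm _) (nrm _) => s t *; nra.
Qed.

Lemma proj_ext p q : is_proj p -> is_proj q -> (forall v, p v = v <-> q v = v) -> p = q.
Proof.
move=> pp pq h; have qp v : q (p v) = p v by apply/h; rewrite (proj_idem _ pp).
have pq' v : p (q v) = q v by apply/h; rewrite (proj_idem _ pq).
apply/funext => v; apply: (ip_eqP hdot) => w.
by rewrite -qp (proj_sym _ _ pq) (proj_sym _ _ pp) pq' -(proj_sym _ _ pq).
Qed.

Lemma tau_proj_mono p q : is_proj p -> is_proj q -> (forall v, p v = v -> q v = v) ->
  (tau p <= tau q)%E.
Proof.
by move=> pp pq h; apply: tau_mono => [||v]; [exact: pos_proj..|exact: proj_ip_mono].
Qed.

(** Normality for sequences: the suprema in the trace axioms are taken for the
operator order, and weak convergence of an increasing sequence identifies such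
a supremum. *)
Lemma tau_sup (A : nat -> H -> H) a (c : \bar R) : (forall n, pos (A n)) ->
  (forall n v, ip (A n v) v <= ip (A n.+1 v) v) -> pos a ->
  (forall n v, ip (A n v) v <= ip (a v) v) ->
  (forall v (eps : R), 0 < eps -> exists n, ip (a v) v - eps < ip (A n v) v) ->
  (forall n, (tau (A n) <= c)%E) -> (tau a <= c)%E.
Proof.
move=> pA incr pa Aa lim tA.
have mono m n : (m <= n)%N -> forall v, ip (A m v) v <= ip (A n v) v.
  move=> /subnKC <-; elim: (n - m)%N => [|k IH] v; first by rewrite addn0.
  by rewrite addnS; apply: le_trans (IH v) (incr _ _).
rewrite (tr_normal htau (A := range A))//.
- by apply: ub_ereal_sup => _ [_ [n _ <-] <-].
- by move=> _ [n _ <-].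
- split; first by exists (A 0%N), 0%N.
  move=> _ _ [m _ <-] [n _ <-]; exists (A (maxn m n)); first by exists (maxn m n).
  by split; apply/op_leP => //; apply: mono; [exact: leq_maxl|exact: leq_maxr].
- split=> //; first by move=> _ [n _ <-]; apply/op_leP.
  move=> c' pc' hc'; apply/op_leP => // v; rewrite -subr_le0.
  apply: (@small_le0 _ _ 1) => // eps e0; have [n hn] := lim v eps e0.
  have : ip (A n v) v <= ip (c' v) v.
    by apply: (proj1 (op_leP (pA n) pc')); apply: hc'; exists n.
  lra.
Qed.

Section Support.
Context (a a' : H -> H) (Ma : M a) (Ma' : M a') (aa' : adjoint_op dot a a').
Context (ac : forall v, nrm (a v) <= nrm v).

Let la := M_lin hM Ma.
Let la' := M_lin hM Ma'.
Let aE v w : ip (a v) w = ip v (a' w).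
Proof. exact: adjoint_ip. Qed.
Let aE' v w : ip (a' v) w = ip v (a w).
Proof. exact: adjoint_ip (adjoint_sym aa'). Qed.

Let ac' v : nrm (a' v) <= nrm v.
Proof.
have [e0|e0] := eqVneq (nrm (a' v)) 0; first by rewrite e0 nrm_ge0.
have {}e0 : 0 < nrm (a' v) by rewrite lt_def e0 nrm_ge0.
rewrite -(ler_pM2r e0) -expr2 -(ipvv hdot) aE'; apply: le_trans (ip_le hdot _ _) _.
by rewrite ler_wpM2l ?nrm_ge0.
Qed.

(** [D = 1 - a^* a] and [E = 1 - a a^*], contractions intertwined by the adjoint
of a. The powers of D decrease to the projection onto the kernel of a. *)
Let D v := v - a' (a v).
Let E v := v - a (a' v).

Let MD : M D.
Proof. by apply: (M_sub hM); [exact: (M_id hM)|exact: (M_comp hM)]. Qed.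

Let MDn n : M (iter n D).
Proof. by elim: n => [|n IH]; [exact: (M_id hM)|exact: (M_comp hM MD IH)]. Qed.

Let Dsym v w : ip (D v) w = ip v (D w).
Proof. by rewrite ipBl ipBr aE' aE. Qed.

Let Dnsym n v w : ip (iter n D v) w = ip v (iter n D w).
Proof. by elim: n v w => [//|n IH] v w; rewrite iterS Dsym IH -iterSr. Qed.

Let D_sq v : nrm (D v) ^+ 2 = nrm v ^+ 2 - 2 * nrm (a v) ^+ 2 + nrm (a' (a v)) ^+ 2.
Proof.
rewrite -!(ipvv hdot) /D !(ipBl, ipBr) (ipC _ (a' _) v) -(aE v (a v)); lra.
Qed.

Let E_sq v : nrm (E v) ^+ 2 = nrm v ^+ 2 - 2 * nrm (a' v) ^+ 2 + nrm (a (a' v)) ^+ 2.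
Proof.
rewrite -!(ipvv hdot) /E !(ipBl, ipBr) (ipC _ (a _) v) -(aE' v (a' v)); lra.
Qed.

Let sq_le u v : nrm u <= nrm v -> nrm u ^+ 2 <= nrm v ^+ 2.
Proof. by move=> h; rewrite ler_pXn2r ?nnegrE ?nrm_ge0. Qed.

Let D_contr v : nrm (D v) ^+ 2 <= nrm v ^+ 2.
Proof. rewrite D_sq; have := sq_le (ac' (a v)); have := sqr_ge0 (nrm (a v)); lra. Qed.

Let Dn_mono v m n : (m <= n)%N -> nrm (iter n D v) ^+ 2 <= nrm (iter m D v) ^+ 2.
Proof.
move=> /subnK <-; rewrite iterD; elim: (n - m)%N (iter m D v) => [//|k IH] u.
by rewrite iterS; apply: le_trans (D_contr _) (IH u).
Qed.

Let Da' n w : iter n D (a' w) = a' (iter n E w).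
Proof. by elim: n => [//|n IH]; rewrite !iterS IH /D /E (linB _ _ la'). Qed.

(** Telescoping: [|E^k w|^2 - |E^(k+1) w|^2] is at least [|a^* E^k w|^2]. *)
Let sum_iter_le n w : \sum_(k < n) nrm (iter k D (a' w)) ^+ 2 <= nrm w ^+ 2.
Proof.
suff : \sum_(k < n) nrm (iter k D (a' w)) ^+ 2 + nrm (iter n E w) ^+ 2 <= nrm w ^+ 2.
  by have := sqr_ge0 (nrm (iter n E w)); lra.
elim: n => [|n IH]; first by rewrite big_ord0 add0r.
rewrite big_ord_recr/= Da' E_sq; have := sq_le (ac (a' (iter n E w))); lra.
Qed.

(** With [b_k = a D^k], [X n] is the sum of the [b_k^* b_k] and [Z n] that of the
[b_k b_k^*] for [k < n]; the trace property equates their traces. *)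
Let X n v := \sum_(k < n) iter k D (a' (a (iter k D v))).
Let Z n v := \sum_(k < n) a (iter k D (iter k D (a' v))).

Let trace_XZ n : pos (X n) /\ pos (Z n) /\ tau (X n) = tau (Z n).
Proof.
have p0 : pos (fun=> 0).
  split; first exact: (M_zero hM).
  by move=> v; rewrite subr0 dot0l.
elim: n => [|n [IHX [IHZ IHt]]].
  have -> : X 0 = fun=> 0 by apply/funext => v; rewrite /X big_ord0.
  have -> : Z 0 = fun=> 0 by apply/funext => v; rewrite /Z big_ord0.
  by [].
pose b v := a (iter n D v); pose b' v := iter n D (a' v).
have Mb : M b by exact: (M_comp hM).
have Mb' : M b' by exact: (M_comp hM).
have bb' : adjoint_op dot b b'.
  apply: adjoint_opP => [|v w]; first exact: (M_lin hM Mb').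
  by rewrite /b /b' aE Dnsym.
have -> : X n.+1 = fun v => X n v + b' (b v).
  by apply/funext => v; rewrite /X big_ord_recr.
have -> : Z n.+1 = fun v => Z n v + b (b' v).
  by apply/funext => v; rewrite /Z big_ord_recr.
have p1 : pos (fun v => b' (b v)) by exact: pos_square.
have p2 : pos (fun v => b (b' v)) by apply: pos_square => //; exact: adjoint_sym.
split; first exact: pos_add.
split; first exact: pos_add.
rewrite !(tr_add htau)// IHt; congr (_ + _)%E.
exact: (tr_tracial htau Mb Mb' bb').
Qed.

(** [Y n = 1 - D^(2 n)] increases to the right support of a. It is at most
[2 X n] because [1 - D^2 = 2 a^* a - (a^* a)^2]. *)
Let Y n v := v - iter n D (iter n D v).

Let Y_ip n v : ip (Y n v) v = nrm v ^+ 2 - nrm (iter n D v) ^+ 2.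
Proof. by rewrite ipBl Dnsym !(ipvv hdot). Qed.

Let Y_X n v : ip (Y n v) v <= ip (X n v) v + ip (X n v) v.
Proof.
rewrite Y_ip; elim: n => [|n IH]; first by rewrite /X big_ord0 ip0l subrr addr0.
have -> : X n.+1 v = X n v + iter n D (a' (a (iter n D v))).
  by rewrite /X big_ord_recr.
rewrite ipDl Dnsym aE' (ipvv hdot) iterS D_sq.
by have := sqr_ge0 (nrm (a' (a (iter n D v)))); lra.
Qed.

(** [v - g v] lies in the closure of the range of the adjoint of a. On that range
the squared norms of the iterates decrease and have a bounded sum, so they tend
to 0. *)
Let Dn_lim g v : is_proj g -> (forall v, g v = v <-> a v = 0) ->
  forall eps : R, 0 < eps -> exists n, nrm (iter n D (v - g v)) ^+ 2 < eps.
Proof.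
move=> pg hg eps e0; pose K := range a'.
have sK : subsp K.
  split; first by exists 0 => //; rewrite lin0.
  by move=> c _ _ [u _ <-] [u' _ <-]; exists (c *: u + u') => //; rewrite la'.
have [q Kq qK] := projection1 hdot (v - g v) (subsp_closure sK) (@closed_closure _ K).
have az : a (v - g v - q) = 0.
  apply: (ip_eqP hdot) => w; rewrite aE ip0l; apply: qK; apply: subset_closure.
  by exists w.
have vq : v - g v = q.
  apply/eqP; rewrite -subr_eq0; apply/eqP/(ipvv_eq0 hdot).
  rewrite [X in ip X _](_ : _ = v - g v - q)// ipBl.
  set z := v - g v - q in az qK *; have gz : g z = z by apply/hg.
  rewrite [ip q z]ipC qK// subr0 -gz ipBl -!(proj_sym _ _ pg) (proj_idem _ pg).
  exact: subrr.
have lD k : linear (iter k D) by exact: (M_lin hM (MDn k)).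
pose d := Num.sqrt eps / 2.
have d0 : 0 < d by rewrite divr_gt0// sqrtr_gt0.
have dd : d ^+ 2 = eps / 4.
  by rewrite /d expr_div_n sqr_sqrtr ?ltW//; congr (_ / _); rewrite expr2; lra.
move/closureP: Kq => /(_ _ d0)[_ [w _ <-] qw].
pose n := truncn (nrm w ^+ 2 / (eps / 4)); exists n.
have h1 : nrm (iter n D (a' w)) ^+ 2 < eps / 4.
  have e4 : 0 < eps / 4 by rewrite divr_gt0.
  have : n.+1%:R * nrm (iter n D (a' w)) ^+ 2 <= nrm w ^+ 2.
    apply: le_trans (sum_iter_le n.+1 w); rewrite -[n.+1 in leLHS]card_ord -sumr_const mulr_suml.
    by apply: ler_sum => k _; rewrite mul1r Dn_mono// -ltnS.
  have : nrm w ^+ 2 < n.+1%:R * (eps / 4) by rewrite -ltr_pdivrMr// truncnS_gt.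
  by move=> h h'; have := le_lt_trans h' h; rewrite ltr_pM2l.
have h2 : nrm (iter n D (q - a' w)) ^+ 2 < d ^+ 2.
  apply: (@le_lt_trans _ _ (nrm (q - a' w) ^+ 2)); first exact: (Dn_mono _ (leq0n n)).
  by rewrite ltr_pXn2r// nnegrE ?nrm_ge0// ltW.
have h3 : nrm (iter n D q) <= nrm (iter n D (a' w)) + nrm (iter n D (q - a' w)).
  by rewrite -[X in iter n D X](subrK (a' w) q) (linD _ _ (lD n)) addrC nrmD.
rewrite vq; move: h1 h2 h3; rewrite dd.
have := nrm_ge0 (iter n D q).
have := nrm_ge0 (iter n D (a' w)); have := nrm_ge0 (iter n D (q - a' w)).
move: (nrm _) (nrm _) (nrm _) => r s t r0 s0 t0 hs hr ht.
have : r ^+ 2 <= (s + t) ^+ 2 by rewrite ler_pXn2r// nnegrE addr_ge0.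
have := sqr_ge0 (s - t); rewrite sqrrB sqrrD; lra.
Qed.

Let Dn_split g n v : is_proj g -> (forall v, g v = v <-> a v = 0) ->
  nrm (iter n D v) ^+ 2 = nrm (g v) ^+ 2 + nrm (iter n D (v - g v)) ^+ 2.
Proof.
move=> pg hg; have lD : linear (iter n D) by exact: (M_lin hM (MDn n)).
have Dg : iter n D (g v) = g v.
  have ag : a (g v) = 0 by apply/hg; rewrite (proj_idem _ pg).
  by elim: n {lD} => [//|n IH]; rewrite iterS IH /D ag lin0// subr0.
have DE : iter n D v = g v + iter n D (v - g v) by rewrite (linB _ _ lD) Dg addrC subrK.
have o : ip (g v) (iter n D (v - g v)) = 0.
  rewrite -Dnsym Dg ipBr -[X in _ - X](proj_sym _ _ pg) (proj_idem _ pg).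
  exact: subrr.
rewrite -!(ipvv hdot) {1 2}DE !ipE o [ip (iter _ _ _) (g v)]ipC o; lra.
Qed.

(** The chain is [tau (Y n) <= 2 tau (X n) = 2 tau (Z n) <= 2 tau p]. Polar
decomposition would give the inequality without the factor 2, which is harmless
below; the polynomials in [a^* a] avoid square roots. *)
Lemma tau_ker_contr g p : is_proj g -> (forall v, g v = v <-> a v = 0) ->
  is_proj p -> (forall v, p (a v) = a v) -> (tau (perp g) <= tau p + tau p)%E.
Proof.
move=> pg hg pp pa; have perp_ip v : ip (perp g v) v = nrm v ^+ 2 - nrm (g v) ^+ 2.
  by rewrite ipBl (ipvv hdot) (proj_ip _ pg).
have pY n : pos (Y n).
  apply: pos_intro => [|v w|v].
  - by apply: (M_sub hM); [exact: (M_id hM)|exact: (M_comp hM)].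
  - by rewrite ipBl ipBr !Dnsym.
  - by rewrite Y_ip subr_ge0 (Dn_mono v (leq0n n)).
apply: (@tau_sup Y) => //.
- by move=> n v; rewrite !Y_ip lerD2l lerN2; exact: Dn_mono.
- by apply: pos_proj; exact: (perp_proj hM).
- by move=> n v; rewrite Y_ip perp_ip lerD2l lerN2 (Dn_split n v pg hg) lerDl sqr_ge0.
- move=> v eps e0; have [n hn] := Dn_lim v pg hg e0; exists n.
  by rewrite Y_ip perp_ip (Dn_split n v pg hg); lra.
- move=> n; have [pXn [pZn tXZ]] := trace_XZ n.
  apply: (@le_trans _ _ (tau (fun v => X n v + X n v))).
    apply: tau_mono => [//||v]; first exact: pos_add.
    by have := Y_X n v; rewrite -ipDl.
  rewrite (tr_add htau)// tXZ; suff h : (tau (Z n) <= tau p)%E by exact: leeD.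
  apply: tau_mono => [//||v]; first exact: pos_proj.
  rewrite (proj_ip _ pp); apply: le_trans (sum_iter_le n (p v)).
  have a'p : a' v = a' (p v).
    apply: (ip_eqP hdot) => w; rewrite !aE' -(pa w) -[in RHS](proj_sym _ _ pp).
    by rewrite -!(proj_sym _ _ pp) (proj_idem _ pp).
  rewrite -a'p /Z; elim: (n) => [|k IH]; first by rewrite !big_ord0 ip0l.
  rewrite !big_ord_recr/= ipDl lerD// aE Dnsym (ipvv hdot)//.
Qed.

End Support.

(** Rescaling a changes neither of its supports, so a may be taken to be a
contraction. *)
Lemma tau_ker a g p (c : R) : M a -> is_proj g -> (forall v, g v = v <-> a v = 0) ->
  is_proj p -> (forall v, p (a v) = a v) -> (tau p <= c%:E)%E ->
  (tau (perp g) <= (2 * c)%:E)%E.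
Proof.
move=> Ma pg hg pp pa pc; have [C C0 aC] := bounded_bound (M_bd hM Ma).
have C1 : 0 < C + 1 by lra.
pose b v := ((C + 1)^-1)%:C%C *: a v.
have Mb : M b by exact: (M_scale hM).
have [b' Mb' bb'] := vna_adj hM Mb.
apply: (@le_trans _ _ (tau p + tau p)%E).
  apply: (@tau_ker_contr b b') => //.
  - move=> v; rewrite nrmZ gtr0_norm ?invr_gt0// mulrC ler_pdivrMr// mulrC.
    by apply: le_trans (aC v) _; rewrite ler_wpM2r ?nrm_ge0//; lra.
  - move=> v; rewrite hg /b; split=> [->|/eqP]; first by rewrite scaler0.
    rewrite scaler_eq0 => /orP[/eqP h|/eqP//]; exfalso.
    by move: h => /complexI/eqP; rewrite invr_eq0 gt_eqF.
  - by move=> v; rewrite (linZ _ _ (proj_lin hM pp)) pa.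
by rewrite mulr_natl mulr2n EFinD; exact: leeD.
Qed.

(** The kernel g of [f^perp e] contains the range of [e^perp], so it commutes
with e, and the meet of e and f is [e g]. *)
Lemma perp_cap e f g : is_proj e -> is_proj f -> is_proj g ->
  (forall v, g v = v <-> perp f (e v) = 0) ->
  forall h, is_proj h -> (forall v, h v = v <-> e v = v /\ f v = v) ->
  perp h = fun v => perp e v + perp g v.
Proof.
move=> pe pf pg hg h ph hh.
have le := proj_lin hM pe; have lg := proj_lin hM pg; have lf := proj_lin hM pf.
have lh := proj_lin hM ph.
have ee v : e (e v) = e v by exact: (proj_idem _ pe).
have gp v : g (v - e v) = v - e v.
  by apply/hg; rewrite (linB _ _ le) ee subrr /perp (lin0 lf) subrr.
have eg v : e (v - g v) = v - g v.
  apply: (ip_eqP hdot) => w; rewrite (proj_sym _ _ pe) ipBl ipBl.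
  have : ip (v - g v) (w - e w) = 0.
    rewrite -(gp w) -(proj_sym _ _ pg) (linB _ _ lg) (proj_idem _ pg) subrr.
    exact: ip0l.
  by rewrite ipBr !ipBl; lra.
pose k v := e v - (v - g v).
have ek v : e (k v) = k v by rewrite /k (linB _ _ le) ee eg.
have gk v : g (k v) = k v.
  have := gp v; rewrite (linB _ _ lg) => h1.
  have h2 : g (e v) = g v - (v - e v) by rewrite -h1 opprB addrC subrK.
  rewrite /k !(linB _ _ lg) (proj_idem _ pg) subrr subr0 h2.
  by rewrite !opprB addrCA addrC.
have fk v : f (k v) = k v.
  by apply/(perpE _ pf); rewrite -{1}ek; apply/hg.
have hk v : h (k v) = k v by apply/hh.
have kh v : k (h v) = h v.
  have [eh fh] : e (h v) = h v /\ f (h v) = h v by apply/hh; rewrite (proj_idem _ ph).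
  have gh : g (h v) = h v by apply/hg; rewrite eh; apply/(perpE _ pf).
  by rewrite /k eh gh subrr subr0.
have sk v w : ip (k v) w = ip v (k w).
  by rewrite /k !ipE (proj_sym _ _ pe) (proj_sym _ _ pg).
have hkE v : h v = k v.
  apply: (ip_eqP hdot) => w.
  rewrite -[k v]hk [RHS](proj_sym _ _ ph) sk kh; exact: (proj_sym _ _ ph).
apply/funext => v; rewrite /perp hkE /k opprB addrC -addrA.
by rewrite addrC; congr (_ + _); rewrite addrC.
Qed.

(** Only one of the two bounds is doubled, so that an iterated meet pays the
factor 2 once for each projection. *)
Lemma tau_cap2 e f h (c d : R) : is_proj e -> is_proj f -> is_proj h ->
  (forall v, h v = v <-> e v = v /\ f v = v) ->
  (tau (perp e) <= c%:E)%E -> (tau (perp f) <= d%:E)%E ->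
  (tau (perp h) <= (c + 2 * d)%:E)%E.
Proof.
move=> pe pf ph hh tc td; have pf' := perp_proj hM pf.
have Ma : M (fun v => perp f (e v)).
  by apply: (M_comp hM); [case: pf'|case: pe].
have [g pg hg] := ker_proj hdot hM Ma.
rewrite (perp_cap pe pf pg hg ph hh).
rewrite (tr_add htau); try by apply: pos_proj; exact: (perp_proj hM).
rewrite EFinD; apply: leeD => //; apply: (tau_ker Ma pg hg pf') => // v.
by rewrite (proj_idem _ pf').
Qed.

(** The finite meets [k n] have co-trace at most [2 d (1 + 1/2 + .. + 2^-n)] and
decrease strongly to the infinite one. *)
Lemma tau_cap (e : nat -> H -> H) (d : R) : (forall n, is_proj (e n)) ->
  (forall n, (tau (perp (e n)) <= (d * 2 ^- n)%:E)%E) ->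
  exists2 h, is_proj h & (forall v, h v = v <-> forall n, e n v = v) /\
    (tau (perp h) <= (4 * d)%:E)%E.
Proof.
move=> pe te; have [h ph hh] := cap_proj hdot hM pe.
exists h => //; split=> //.
have /choice[k hk] : forall n : nat, exists k, is_proj k /\
    forall v, k v = v <-> forall i : 'I_n.+1, e i v = v.
  move=> n; have [k ? ?] := cap_proj hdot hM (fun i : 'I_n.+1 => pe i).
  by exists k.
have pk n : is_proj (k n) by exact: (hk n).1.
have ppk n : is_proj (perp (k n)) by exact: (perp_proj hM).
have kE n v : k n v = v <-> forall m, (m <= n)%N -> e m v = v.
  split=> [/(hk n).2 h1 m mn|h1]; first exact: (h1 (Ordinal (mn : (m < n.+1)%N))).
  by apply/(hk n).2 => -[m mn]; exact: h1.
have d0 : 0 <= d.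
  have := tr_ge0 htau (pos_proj (perp_proj hM (pe 0%N))).
  by move=> /le_trans/(_ (te 0%N)); rewrite lee_fin invr1 mulr1.
have tk n : (tau (perp (k n)) <= (4 * d - 2 * d * 2 ^- n)%:E)%E.
  elim: n => [|n IH].
    have -> : k 0%N = e 0%N.
      apply: proj_ext => // v; rewrite kE; split=> [|h0 m]; first exact.
      by rewrite leqn0 => /eqP ->.
    apply: le_trans (te 0%N) _; rewrite lee_fin expr0 invr1; lra.
  have := @tau_cap2 (k n) (e n.+1) (k n.+1) _ _ (pk n) (pe n.+1) (pk n.+1) _ IH (te n.+1).
  rewrite (_ : 4 * d - 2 * d * 2 ^- n + 2 * _ = 4 * d - 2 * d * 2 ^- n.+1); last first.
    by rewrite exprS invfM; move: (2 ^- n) => z; lra.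
  apply=> v; rewrite !kE; split=> [h1|[h1 h2] m]; last first.
    by rewrite leq_eqVlt => /orP[/eqP ->//|]; exact: h1.
  by split=> [m mn|]; apply: h1 => //; exact: leqW.
have kk m n : (m <= n)%N -> forall v, k n v = v -> k m v = v.
  by move=> mn v /kE h1; apply/kE => i im; apply: h1; exact: leq_trans mn.
have kmono v m n : (m <= n)%N -> ip (k n v) v <= ip (k m v) v.
  by move=> mn; apply: proj_ip_mono => //; exact: kk.
have hk' n v : h v = v -> k n v = v by move=> /hh h1; apply/kE.
have lim v : tends (fun n => k n v) (h v).
  pose r n := ip (k n v) v.
  have hinf : has_inf (range r).
    split; first by exists (r 0%N), 0%N.
    by exists 0 => _ [n _ <-]; rewrite /r (proj_ip _ (pk n)) sqr_ge0.
  have dist m n : (m <= n)%N -> nrm (k m v - k n v) ^+ 2 = r m - r n.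
    move=> mn; have kmn : k m (k n v) = k n v by apply: (kk _ _ mn); rewrite (proj_idem _ (pk n)).
    have o : ip (k m v) (k n v) = r n.
      by rewrite (proj_sym _ _ (pk m)) kmn /r ipC.
    rewrite -(ipvv hdot) !ipE o (ipC _ (k n v)) o !(ipvv hdot).
    by rewrite /r !(proj_ip _ (pk _)); lra.
  have [q kq] : exists q : H, tends (fun n => k n v) q.
    apply: complete_tends => eps e0.
    have [_ [n0 _ <-] h0] := inf_adherent (exprn_gt0 2 e0) hinf.
    have key m n : (n0 <= m)%N -> (m <= n)%N -> nrm (k m v - k n v) < eps.
      move=> h1 h2; rewrite -(@ltr_pXn2r _ 2) ?nnegrE ?nrm_ge0// ?ltW// dist//.
      have : inf (range r) <= r n by apply: ge_inf; [exact: hinf.2|exists n].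
      by have := kmono v _ _ h1; rewrite -!/(r _); lra.
    exists n0 => m n hm hn; case: (leqP m n) => mn; first exact: key.
    by rewrite nrmBC key// ltnW.
  have eq i : e i q = q.
    have Me : M (e i) by case: (pe i).
    apply: (tends_unique (tends_op (M_bd hM Me) (tends_shift i kq))).
    have -> : (fun n => e i (k (n + i)%N v)) = fun n => k (n + i)%N v.
      apply/funext => n; have /kE := proj_idem v (pk (n + i)%N).
      by apply; exact: leq_addl.
    exact: (tends_shift i kq).
  have hq : h q = q by apply/hh.
  suff -> : h v = q by [].
  apply: (ip_eqP hdot) => w; rewrite -[in RHS]hq !(proj_sym _ _ ph).
  apply/eqP; rewrite eq_sym -subr_eq0 -ipBl; apply/eqP.
  apply: (tends_ip0 hdot (u := fun n => k n v - v)).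
    by apply: tendsB => //; exact: tends_cst.
  move=> n; rewrite ipBl (proj_sym _ _ (pk n)) hk' ?subrr//.
  by rewrite (proj_idem _ ph).
apply: (@tau_sup (fun n => perp (k n))) => [n|n v||n v|v eps e0|n].
- exact: pos_proj.
- by rewrite !ipBl lerD2l lerN2; apply: kmono.
- by apply: pos_proj; exact: (perp_proj hM).
- by rewrite !ipBl lerD2l lerN2; apply: proj_ip_mono => // u; exact: hk'.
- have v1 : 0 < nrm v + 1 by have := nrm_ge0 v; lra.
  have [n hn] := lim v (eps / (nrm v + 1)) (divr_gt0 e0 v1); exists n.
  have := ip_le hdot (k n v - h v) v; have := hn n (leqnn n).
  rewrite ltr_pdivlMr// !ipBl; have := nrm_ge0 (k n v - h v); have := nrm_ge0 v.
  by move: (nrm _) (nrm _) (ip _ _) (ip _ _) (ip _ _) => s t *; nra.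
- apply: le_trans (tk n) _; rewrite lee_fin lerBlDr lerDl mulr_ge0//.
  by rewrite mulr_ge0.
Qed.

(** A vector orthogonal to K is fixed by the meet of all [(e n)^perp], a
projection of trace 0. *)
Lemma tau_dense K : subsp K ->
  (forall eps : R, 0 < eps -> exists e,
     [/\ is_proj e, (tau (perp e) <= eps%:E)%E & forall v, K (e v)]) ->
  forall v, closure K v.
Proof.
move=> sK hK; apply: (subsp_dense hdot sK) => v vK.
have /choice[e he] : forall n : nat, exists e,
    [/\ is_proj e, (tau (perp e) <= (2 ^- n)%:E)%E & forall v, K (e v)].
  by move=> n; apply: hK; rewrite invr_gt0 exprn_gt0.
have pe n : is_proj (perp (e n)) by apply: (perp_proj hM); case: (he n).
have [p pp hp] := cap_proj hdot hM pe.
have tp n : (tau p <= (2 ^- n)%:E)%E.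
  have [_ te _] := he n; apply: le_trans te.
  by apply: tau_proj_mono => // u /hp.
have tp0 : tau p = 0%E.
  apply/eqP; rewrite eq_le (tr_ge0 htau) ?andbT; last exact: pos_proj.
  apply/lee_addgt0Pr => eps e0; rewrite add0e.
  have [n h] := half_small e0; apply: le_trans (tp n) _.
  by rewrite lee_fin ltW// h.
have p0 := tr_faithful htau (pos_proj pp) tp0.
suff <- : p v = v by rewrite p0.
apply/hp => n; have [pen _ Ke] := he n.
suff h : e n v = 0 by rewrite /perp h subr0.
by apply: (ip_eqP hdot) => w; rewrite (proj_sym _ _ pen) ip0l vK.
Qed.

End Trace.

(** * Strongly dense domains and closed relations *)

Section Tame.
Context {R : realType} {H : completeNormedModType R[i]}.
Context (dot : {dot H for conjC}) (hdot : induces_norm dot).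
Context (M : set (H -> H)) (hM : von_neumann_algebra dot M).
Context (tau : (H -> H) -> \bar R) (htau : fns_trace dot M tau).
Implicit Types (u v w : H) (a b c e f g h p q T : H -> H) (K : set H) (G x y : set (H * H)).
Local Notation ip := (reip dot).
Local Notation M' := (commutant M).
Local Notation is_proj := (is_proj dot M).
Local Notation L0 := (L0 dot M tau).

Lemma proj_M e : is_proj e -> M e.
Proof. by case. Qed.

Lemma proj_subr p q v : is_proj p -> is_proj q -> (forall v, p v = v -> q v = v) ->
  p (q v) = p v.
Proof.
move=> pp pq h; apply: (ip_eqP hdot) => w.
by rewrite (proj_sym _ _ pp) (proj_sym _ _ pq) (h (p w)) ?(proj_idem _ pp)// -(proj_sym _ _ pp).
Qed.

Lemma proj_cap2 e f (c d : R) : is_proj e -> is_proj f ->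
  (tau (perp e) <= c%:E)%E -> (tau (perp f) <= d%:E)%E ->
  exists h, [/\ is_proj h, (tau (perp h) <= (c + 2 * d)%:E)%E,
    forall v, h v = v -> e v = v & forall v, h v = v -> f v = v].
Proof.
move=> pe pf te tf.
have pef (b : bool) : is_proj (if b then e else f) by case: b.
have [h ph hh] := cap_proj hdot hM pef.
exists h; split=> //.
- apply: (tau_cap2 hdot hM htau pe pf ph) => // v; rewrite hh; split=> [h1|[h1 h2] []//].
  by split; [exact: (h1 true)|exact: (h1 false)].
- by move=> v /hh/(_ true).
- by move=> v /hh/(_ false).
Qed.

Lemma proj_tails (e : nat -> H -> H) (d : R) : (forall n, is_proj (e n)) ->
  (forall n, (tau (perp (e n)) <= (d * 2 ^- n)%:E)%E) ->
  exists h : nat -> H -> H, forall n, [/\ is_proj (h n),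
    forall v, h n v = v <-> forall m, (n <= m)%N -> e m v = v
  & (tau (perp (h n)) <= (4 * d * 2 ^- n)%:E)%E].
Proof.
move=> pe te.
suff /choice[h hh] : forall n, exists h, [/\ is_proj h,
    forall v, h v = v <-> forall m, (n <= m)%N -> e m v = v
  & (tau (perp h) <= (4 * d * 2 ^- n)%:E)%E] by exists h.
move=> n.
have te' k : (tau (perp (e (n + k)%N)) <= ((d * 2 ^- n) * 2 ^- k)%:E)%E.
  by rewrite -mulrA -invfM -exprD addnC (le_trans (te _)) // addnC.
have [h ph [hh th]] := tau_cap hdot hM htau (fun k => pe (n + k)%N) te'.
exists h; split=> //; last by rewrite -mulrA.
move=> v; rewrite hh; split=> h1 m; last by apply: h1; exact: leq_addr.
by move=> /subnKC <-.
Qed.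

Lemma tau_zero w : (forall eps : R, 0 < eps -> exists q,
    [/\ is_proj q, (tau (perp q) <= eps%:E)%E & q w = 0]) -> w = 0.
Proof.
move=> hw; pose K := [set v | dot v w = 0].
have sK : subsp K.
  by split=> [|c u v h1 h2]; rewrite /K/= ?dot0l// dotDl dotZl h1 h2 mulr0 addr0.
have /closure_seqP[u [Ku uw]] : closure K w.
  apply: (tau_dense hdot hM htau sK) => eps /hw[q [pq tq qw]]; exists q; split=> // v.
  by case: pq => _ qq _; rewrite /K/= qq qw dotC dot0l rmorph0.
apply: (ipvv_eq0 hdot); apply: (tends_ip0 hdot uw) => n.
by rewrite /reip Ku.
Qed.

Definition comm_stable G := forall b, M' b -> stable b G.

(** The last two conditions are boundedness after multiplication by a large
projection on the right and on the left. For a closed affiliated relation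
tau-measurability amounts to the third condition, and implies the fourth. *)
Definition tame G := [/\ subsp G, comm_stable G,
  forall eps : R, 0 < eps -> exists e b,
    [/\ is_proj e, M b, (tau (perp e) <= eps%:E)%E & forall v, G (e v, b v)]
& forall eps : R, 0 < eps -> exists q c,
    [/\ is_proj q, M c, (tau (perp q) <= eps%:E)%E
      & forall v w, G (v, w) -> q w = c v]].

(** Left boundedness is inherited by the closure, so this is where closability
comes from. *)
Lemma tame_inj G v w w' : tame G -> G (v, w) -> G (v, w') -> w = w'.
Proof.
move=> [sG _ _ lG] Gw Gw'; apply/eqP; rewrite -subr_eq0; apply/eqP/tau_zero.
move=> eps /lG[q [c [pq Mc tq qc]]]; exists q; split=> //.
by rewrite (linB _ _ (proj_lin hM pq)) (qc _ _ Gw) (qc _ _ Gw') subrr.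
Qed.

Lemma linear_graph_subsp x : linear_graph x -> subsp x.
Proof. by move=> [x0 xl _]; split=> // c [? ?] [? ?]; exact: xl. Qed.

Lemma tame_closure G : tame G -> tame (closure G).
Proof.
move=> [sG iG rG lG]; split.
- exact: subsp_closure.
- move=> b Mb v w /closure_seqP[u [Gu uvw]]; apply/closure_seqP.
  have bb := comm_bd Mb.
  exists (fun n => (b (u n).1, b (u n).2)); split.
    by move=> n; apply: iG => //; case: (u n) (Gu n).
  apply: tends_pair; apply: tends_op => //.
    exact: (tends_fst uvw).
  exact: (tends_snd uvw).
- move=> eps /rG[e [b [pe Mb te Gb]]]; exists e, b; split=> // v.
  exact: subset_closure.
- move=> eps /lG[q [c [pq Mc tq qc]]]; exists q, c; split=> // v w.
  move=> /closure_seqP[u [Gu uvw]].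
  apply: (tends_unique (tends_op (M_bd hM (proj_M pq)) (tends_snd uvw))).
  have -> : (fun n => q (u n).2) = fun n => c (u n).1.
    by apply/funext => n; apply: qc; case: (u n) (Gu n).
  exact: (tends_op (M_bd hM Mc) (tends_fst uvw)).
Qed.

Lemma tame_L0 G : tame G -> closed G -> L0 G.
Proof.
move=> tG cG; have [sG iG rG lG] := tG; split=> //.
- split; first exact: sG.1.
    by move=> c v w v' w' h1 h2; have := sG.2 c _ _ h1 h2.
  by move=> v w w'; exact: tame_inj.
- have sD : subsp (op_dom G).
    split; first by exists 0; exact: sG.1.
    move=> c v v' [w Gw] [w' Gw']; exists (c *: w + w').
    exact: (sG.2 c _ _ Gw Gw').
  have dD : forall v, closure (op_dom G) v.
    apply: (tau_dense hdot hM htau sD) => eps /rG[e [b [pe Mb te Gb]]].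
    by exists e; split=> // v; exists (b v).
  move=> O [v Ov] oO; have [w [Dw Ow]] := dD v O (open_nbhs_nbhs (conj oO Ov)).
  by exists w.
- move=> u Mu [bu [u' uu' [u1 u2]]] v w; split; first exact: iG.
  have [u'' Mu'' uu''] := comm_adjoint hdot hM Mu.
  have E z : u'' z = u' z.
    by apply: (ip_eqP hdot) => t; rewrite ipC -(adjoint_ip _ _ uu'') (adjoint_ip _ _ uu') ipC.
  have K z : u' (u z) = z by have := congr1 (fun f => f z) u2.
  by move=> /(iG _ Mu''); rewrite !E !K.
- move=> eps /rG[e [b [pe Mb te Gb]]]; exists e; split=> //.
  by move=> _ [v _ <-]; exists (b v).
Qed.

(** The operator [x e] is closed and everywhere defined, hence bounded, and it
commutes with the commutant because x and e do. *)
Lemma everywhere_defined_bounded x e : linear_graph x -> closed x -> comm_stable x ->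
  is_proj e -> (forall v, op_dom x (e v)) ->
  exists2 b, M b & forall v, x (e v, b v).
Proof.
move=> lx cx ix pe dx; have sx := linear_graph_subsp lx.
have le := proj_lin hM pe; have Me := proj_M pe.
pose T := [set p : H * H | x (e p.1, p.2)].
have lT : linear_graph T.
  split; first by rewrite /T/= (lin0 le); exact: sx.1.
    by move=> c v w v' w' h1 h2; rewrite /T/= le; have := sx.2 c _ _ h1 h2.
  by move=> v w w'; rewrite /T/=; case: lx => _ _; exact.
have cT : closed T.
  apply: closed_seq => u l Tu ul; apply: (closed_tends cx Tu).
  by apply: tends_pair (tends_snd ul); exact: (tends_op (M_bd hM Me) (tends_fst ul)).
have [b bb bT] := closed_graph hdot lT cT dx.
exists b; last by move=> v; apply/bT.
apply: (M_intro hM bb) => d Md v; apply/bT.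
rewrite /T/= (comm_swap _ Me Md); apply: (ix _ Md).
exact: (proj2 (bT v _)).
Qed.

(** The vectors that T maps into the range of e form the kernel of [e^perp T],
whose co-trace is at most twice that of e. *)
Lemma tau_dense_preimage T K : M T -> subsp K ->
  (forall eps : R, 0 < eps -> exists e,
    [/\ is_proj e, (tau (perp e) <= eps%:E)%E & forall v, K (e v)]) ->
  forall u, closure [set u | K (T u)] u.
Proof.
move=> MT sK dK; have lT := M_lin hM MT.
have sW : subsp [set u | K (T u)].
  split; first by rewrite /= lin0//; exact: sK.1.
  by move=> c v v' Kv Kv'; rewrite /= lT; exact: sK.2.
apply: (tau_dense hdot hM htau sW) => eps e0.
have [e [pe te Ke]] := dK (eps / 2) (divr_gt0 e0 (ltr0n _ 2)).
have pe' := perp_proj hM pe.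
have Ma : M (fun v => perp e (T v)) by apply: (M_comp hM) => //; exact: proj_M.
have [g pg hg] := ker_proj hdot hM Ma.
exists g; split=> //.
  have := tau_ker hdot hM htau Ma pg hg pe' (fun v => proj_idem (T v) pe') te.
  by rewrite mulrC divfK.
move=> v; rewrite /=.
suff <- : e (T (g v)) = T (g v) by exact: Ke.
by apply/(perpE _ pe); apply/hg; rewrite (proj_idem _ pg).
Qed.

(** Project onto x: the pairs [(B u, C u)] are dense in x, and those with [B u]
in the domain of G belong to G. The latter vectors u are dense by
[tau_dense_preimage]. *)
Lemma core_closure x G : linear_graph x -> closed x -> comm_stable x -> G `<=` x -> subsp G ->
  (forall eps : R, 0 < eps -> exists e,
    [/\ is_proj e, (tau (perp e) <= eps%:E)%E & forall v, op_dom G (e v)]) ->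
  x `<=` closure G.
Proof.
move=> lx cx ix Gx sG dG; have sx := linear_graph_subsp lx.
have [B [C [bB bC BC orth comm]]] := graph_projection hdot sx cx.
have MB : M B.
  apply: (M_intro hM bB) => b Mb v; have [b' Mb' bb'] := comm_adjoint hdot hM Mb.
  by have [->] := comm b b' (comm_lin Mb) bb' (ix _ Mb) (ix _ Mb') v.
have sD : subsp (op_dom G).
  split; first by exists 0; exact: sG.1.
  by move=> c v v' [w Gw] [w' Gw']; exists (c *: w + w'); exact: (sG.2 c _ _ Gw Gw').
have dW := tau_dense_preimage MB sD dG.
have BCG u : closure G (B u, C u).
  have /closure_seqP[s [Ws su]] := dW u.
  apply/closure_seqP; exists (fun n => (B (s n), C (s n))); split.
    move=> n; have [w Gw] := Ws n; suff <- : w = C (s n) by [].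
    by case: lx => _ _ inj; apply: (inj (B (s n))) => //; exact: Gx.
  by apply: tends_pair; apply: tends_op.
move=> [v w] xvw.
have [[q1 q2] Gq o] := projection2 hdot (v, w) (subsp_closure sG) (@closed_closure _ G).
have xq : x (q1, q2).
  have /closure_seqP[s [Gs sq]] := Gq.
  by apply: (closed_tends cx _ sq) => n; exact: Gx.
have xr : x (v - q1, w - q2) := subspB sx xvw xq.
(* A pair of x orthogonal to all (B u, C u) is orthogonal to all (u, 0). *)
have r1 : v - q1 = 0.
  apply: (ipvv_eq0 hdot); have := o _ (BCG (v - q1)); have := orth (v - q1) _ _ xr.
  by rewrite /ip2/= ipBl (ipC _ (B _)) (ipC _ (C _)); lra.
have r2 : w - q2 = 0.
  by case: lx => _ _; apply; last exact: sx.1; rewrite -r1; exact: xr.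
move/eqP: r1; rewrite subr_eq0 => /eqP ->.
by move/eqP: r2; rewrite subr_eq0 => /eqP ->.
Qed.

(** The increment [b (n+1) - b n] vanishes on the range of [f n], so its right
support, and with it its left support, has small trace. A projection q
orthogonal to the left supports of all increments from N on satisfies
[q b n = q b N] for all later n. *)
Lemma left_bound (f b : nat -> H -> H) (d : R) : (forall n, is_proj (f n)) ->
  (forall n v, f n.+1 (f n v) = f n v) ->
  (forall n, (tau (perp (f n)) <= (d * 2 ^- n)%:E)%E) ->
  (forall n, M (b n)) -> (forall n v, b n.+1 (f n v) = b n v) ->
  forall eps : R, 0 < eps -> exists q c,
    [/\ is_proj q, M c, (tau (perp q) <= eps%:E)%E
      & forall n v, f n v = v -> q (b n v) = c v].
Proof.
move=> pf ff tf Mb bf eps e0.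
have d1 : 0 < `|d| + 1 by have := normr_ge0 d; lra.
have [N hN] := half_small (divr_gt0 e0 (mulr_gt0 (ltr0n R 8) d1)).
have dN : 4 * (2 * (d * 2 ^- N)) <= eps.
  have := hN N (leqnn _); rewrite ltr_pdivlMr ?mulr_gt0//.
  have : 0 < 2 ^- N :> R by rewrite invr_gt0 exprn_gt0.
  by have := ler_norm d; move: (2 ^- N) (`|d|) => z t *; nra.
have bS n v : f n v = v -> b n.+1 v = b n v by move=> fv; rewrite -[in LHS]fv bf.
have Mc n : M (fun v => b n.+1 v - b n v) by exact: (M_sub hM).
have /choice[q hq] : forall k : nat, exists q,
    [/\ is_proj q, (tau (perp q) <= ((2 * (d * 2 ^- N)) * 2 ^- k)%:E)%E
      & forall v, q v = v -> forall u, ip (b (N + k).+1 u - b (N + k)%N u) v = 0].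
  move=> k; have [c' Mc' cc'] := vna_adj hM (Mc (N + k)%N).
  have [q pq hq] := ker_proj hdot hM Mc'.
  exists q; split=> //; last first.
    by move=> v /hq cv u; rewrite (adjoint_ip u v cc') cv ip0r.
  have pf' := perp_proj hM (pf (N + k)%N).
  rewrite (_ : _ * _ = 2 * (d * 2 ^- (N + k))); last first.
    by rewrite exprD invfM !mulrA.
  apply: (tau_ker hdot hM htau Mc' pq hq pf' _ (tf _)) => v.
  apply/(perpE _ pf'); rewrite /perp opprB addrC subrK.
  apply: (ip_eqP hdot) => w; rewrite (proj_sym _ _ (pf _)) ip0l ipC.
  by rewrite -(adjoint_ip _ _ cc') (bS _ _ (proj_idem _ (pf _))) subrr ip0l.
(* r is orthogonal to the left supports of all increments from N on. *)
have [r pr [hr tr]] := tau_cap hdot hM htau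
  (fun k => let: And3 x _ _ := hq k in x) (fun k => let: And3 _ x _ := hq k in x).
exists r, (fun v => r (b N v)); split=> //.
- by apply: (M_comp hM) => //; exact: proj_M.
- by apply: le_trans tr _; rewrite lee_fin.
- have rb k v : r (b (N + k)%N v) = r (b N v).
    elim: k => [|k <-]; first by rewrite addn0.
    rewrite addnS; apply/eqP; rewrite -subr_eq0; apply/eqP/(ip_eqP hdot) => w.
    rewrite -(linB _ _ (proj_lin hM pr)) (proj_sym _ _ pr) ip0l.
    have [_ _ hqk] := hq k; apply: hqk; apply: (proj1 (hr (r w))).
    exact: (proj_idem _ pr).
  move=> n v fv.
  have fk k : f (n + k)%N v = v.
    by elim: k => [|k IH]; [rewrite addn0|rewrite addnS -[in LHS]IH ff].
  have -> : b n v = b (N + n)%N v; last exact: rb.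
  rewrite addnC; elim: (N) => [|k IH]; first by rewrite addn0.
  by rewrite addnS bS.
Qed.

(** [left_bound] applies to the restriction of x to an increasing union of ranges,
and x is the closure of this restriction. *)
Lemma L0_tame x : L0 x -> tame x.
Proof.
move=> [lx cx _ ax mx]; have sx := linear_graph_subsp lx.
have ix : comm_stable x by exact: (affiliated_stable hdot hM sx cx ax).
have inj v w w' : x (v, w) -> x (v, w') -> w = w' by case: lx => _ _; exact.
have rx : forall eps : R, 0 < eps -> exists e b,
    [/\ is_proj e, M b, (tau (perp e) <= eps%:E)%E & forall v, x (e v, b v)].
  move=> eps /mx[e [pe te De]].
  have [v|b Mb xb] := everywhere_defined_bounded lx cx ix pe; first by apply: De; exists v.
  by exists e, b.
split=> // eps e0.
have /choice[e he] : forall n : nat, exists e,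
    [/\ is_proj e, (tau (perp e) <= (1 * 2 ^- n)%:E)%E & forall v, op_dom x (e v)].
  move=> n; have [|e [b [pe Mb te xb]]] := rx (1 * 2 ^- n).
    by rewrite mul1r invr_gt0 exprn_gt0.
  by exists e; split=> // v; exists (b v).
have [h hh] := proj_tails (fun k => let: And3 x _ _ := he k in x)
  (fun k => let: And3 _ x _ := he k in x).
have ph n : is_proj (h n) by case: (hh n).
have hE n v : h n v = v <-> forall m, (n <= m)%N -> e m v = v by case: (hh n).
have /choice[b hb] : forall n, exists b, M b /\ forall v, x (h n v, b v).
  move=> n; have [v|b Mb xb] := everywhere_defined_bounded lx cx ix (ph n); last by exists b.
  have /hE/(_ n (leqnn n)) <- := proj_idem v (ph n).
  by case: (he n).
have hS n v : h n v = v -> h n.+1 v = v.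
  by move=> /hE h1; apply/hE => m nm; apply: h1; exact: ltnW.
have hb' n v w : h n v = v -> x (v, w) -> w = b n v.
  by move=> hv xvw; apply: (inj v) => //; rewrite -[X in (X, _)]hv; exact: (hb n).2.
have [||||q [c [pq Mc tq qc]]] := @left_bound h b (4 * 1) ph _ _ _ _ eps e0.
- by move=> n v; apply: hS; exact: (proj_idem _ (ph n)).
- by move=> n; case: (hh n).
- by move=> n; exact: (hb n).1.
- move=> n v; apply/esym; apply: hb'; last exact: (hb n).2.
  by apply: hS; exact: (proj_idem _ (ph n)).
exists q, c; split=> // v w xvw.
pose G := [set p : H * H | x p /\ exists n, h n p.1 = p.1].
have hmono m n u : (m <= n)%N -> h m u = u -> h n u = u.
  by move=> /subnKC <- hu; elim: (n - m)%N => [|k IH]; rewrite ?addn0// addnS hS.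
have sG : subsp G.
  split; first by split; [exact: sx.1|exists 0%N; exact: (lin0 (proj_lin hM (ph _)))].
  move=> d k l [xk [n hn]] [xl [m hm]]; split; first exact: sx.2.
  exists (maxn n m); rewrite /= (proj_lin hM (ph _)).
  by rewrite (hmono _ _ _ (leq_maxl n m) hn) (hmono _ _ _ (leq_maxr n m) hm).
have /closure_seqP[s [Gs sv]] : closure G (v, w).
  apply: (core_closure lx cx ix _ sG) => // [p []//|d d0].
  have [n hn] := half_small (divr_gt0 d0 (ltr0n R 4)).
  exists (h n); split=> //.
    have [_ _ th] := hh n; apply: le_trans th _; rewrite lee_fin.
    by have := hn n (leqnn n); rewrite ltr_pdivlMr//; lra.
  move=> u; exists (b n u); split; first exact: (hb n).2.
  by exists n; exact: (proj_idem _ (ph n)).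
apply: (tends_unique (tends_op (M_bd hM (proj_M pq)) (tends_snd sv))).
have -> : (fun n => q (s n).2) = fun n => c (s n).1.
  apply/funext => n; have [xs [m hm]] := Gs n.
  rewrite -(qc _ _ hm); congr (q _); apply: hb' => //.
  by case: (s n) xs.
exact: (tends_op (M_bd hM Mc) (tends_fst sv)).
Qed.

(** The strong difference [L0_sub x y] is the closure of this relation. *)
Definition diff x y := [set p : H * H |
  exists w w', [/\ x (p.1, w), y (p.1, w') & p.2 = w - w']].

Lemma tame_diff x y : tame x -> tame y -> tame (diff x y).
Proof.
move=> [sx ix rx lx] [sy iy ry ly]; split.
- split; first by exists 0, 0; split; [exact: sx.1|exact: sy.1|rewrite subrr].
  move=> c [v k] [v' k'] [w [w' [/= h1 h2 ->]]] [z [z' [/= h3 h4 ->]]].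
  exists (c *: w + z), (c *: w' + z'); split=> /=.
  + exact: (sx.2 c _ _ h1 h3).
  + exact: (sy.2 c _ _ h2 h4).
  + by rewrite scalerBr opprD addrACA.
- move=> b Mb v k [w [w' [/= h1 h2 ->]]]; exists (b w), (b w'); split=> /=.
  + exact: ix.
  + exact: iy.
  + by rewrite (linB _ _ (comm_lin Mb)).
- move=> eps e0; have e3 : 0 < eps / 3 by rewrite divr_gt0.
  have [e1 [b1 [pe1 Mb1 te1 xb1]]] := rx _ e3; have [e2 [b2 [pe2 Mb2 te2 yb2]]] := ry _ e3.
  have [e [pe te h1 h2]] := proj_cap2 pe1 pe2 te1 te2.
  exists e, (fun v => b1 (e v) - b2 (e v)); split=> //.
  + by apply: (M_sub hM); apply: (M_comp hM) => //; exact: proj_M.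
  + by apply: le_trans te _; rewrite lee_fin; lra.
  + move=> v; exists (b1 (e v)), (b2 (e v)); split=> //=.
      by rewrite -{1}(h1 (e v)) ?(proj_idem _ pe).
    by rewrite -{1}(h2 (e v)) ?(proj_idem _ pe).
- move=> eps e0; have e3 : 0 < eps / 3 by rewrite divr_gt0.
  have [q1 [c1 [pq1 Mc1 tq1 qc1]]] := lx _ e3; have [q2 [c2 [pq2 Mc2 tq2 qc2]]] := ly _ e3.
  have [q [pq tq h1 h2]] := proj_cap2 pq1 pq2 tq1 tq2.
  exists q, (fun v => q (c1 v) - q (c2 v)); split=> //.
  + by apply: (M_sub hM); apply: (M_comp hM) => //; exact: proj_M.
  + by apply: le_trans tq _; rewrite lee_fin; lra.
  + move=> v k [w [w' [/= xw yw' ->]]]; rewrite (linB _ _ (proj_lin hM pq)).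
    by rewrite -(proj_subr w pq pq1 h1) -(proj_subr w' pq pq2 h2) (qc1 _ _ xw) (qc2 _ _ yw').
Qed.

Lemma L0_sub_tame x y : L0 x -> L0 y -> tame (L0_sub x y).
Proof. by move=> /L0_tame tx /L0_tame ty; apply: tame_closure; exact: tame_diff. Qed.

(** The strong difference S of x and [L0_sub x y] contains [(u, w - z)], and it
contains the restriction of y to the domain of x. By [core_closure], S is the closure
of this restriction, so it is contained in y. *)
Lemma sub_cancel x y u z w : L0 x -> L0 y -> L0_sub x y (u, z) -> x (u, w) ->
  y (u, w - z).
Proof.
move=> Lx Ly uz uw; have tx := L0_tame Lx; have ty := L0_tame Ly.
have tD := L0_sub_tame Lx Ly.
pose S := closure (diff x (L0_sub x y)).
have tS : tame S by apply: tame_closure; exact: tame_diff.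
have cS : closed S by exact: closed_closure.
have [lS _ _ _ _] := tame_L0 tS cS.
have [_ cy _ _ _] := Ly.
have [sx ix rx _] := tx; have [sy _ ry _] := ty.
pose G := [set p | y p /\ op_dom x p.1].
have SG : S `<=` closure G.
  apply: core_closure => //.
  - by case: tS.
  - move=> [v w'] [/= yw' [k xk]]; apply: subset_closure.
    exists k, (k - w'); split=> //=; last by rewrite opprB addrC subrK.
    by apply: subset_closure; exists k, w'.
  - split; first by split; [exact: sy.1|exists 0; exact: sx.1].
    move=> c k l [yk [k' xk]] [yl [l' xl]]; split; first exact: sy.2.
    by exists (c *: k' + l'); exact: (sx.2 c _ _ xk xl).
  - move=> eps e0; have e3 : 0 < eps / 3 by rewrite divr_gt0.
    have [e1 [b1 [pe1 Mb1 te1 xb1]]] := rx _ e3; have [e2 [b2 [pe2 Mb2 te2 yb2]]] := ry _ e3.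
    have [e [pe te h1 h2]] := proj_cap2 pe1 pe2 te1 te2.
    exists e; split=> //; first by apply: le_trans te _; rewrite lee_fin; lra.
    move=> v; exists (b2 (e v)); split=> /=.
      by rewrite -{1}(h2 (e v)) ?(proj_idem _ pe).
    by exists (b1 (e v)); rewrite -{1}(h1 (e v)) ?(proj_idem _ pe).
have /SG/closure_seqP[s [Gs sl]] : S (u, w - z).
  by apply: subset_closure; exists w, z.
by apply: (closed_tends cy _ sl) => n; case: (Gs n).
Qed.

End Tame.

(** * The uniform norm *)

Section UniformNorm.
Context {R : realType} {H : completeNormedModType R[i]}.
Context (M : set (H -> H)).
Implicit Types (a : H -> H) (y : set (H * H)).

Lemma unorm_ge0 y : (0 <= unorm M y)%E.
Proof. by apply: le_ereal_inf_tmp => _ [c [c0 _] <-]; rewrite lee_fin. Qed.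

Lemma unorm_graph_le a (d : R) : M a -> 0 <= d ->
  (forall v, nrm (a v) <= d * nrm v) -> (unorm M (op_graph a) <= d%:E)%E.
Proof.
move=> Ma d0 ad; apply: ereal_inf_lbound; exists d => //; split=> //.
by exists a; split=> // v; rewrite !nrmE -rmorphM/= lecR.
Qed.

Lemma unorm_le_graph y (c d : R) : (unorm M y <= c%:E)%E -> c < d ->
  exists2 a, M a & y = op_graph a /\ forall v, nrm (a v) <= d * nrm v.
Proof.
move=> yc cd; have : (unorm M y < d%:E)%E by apply: le_lt_trans yc _; rewrite lte_fin.
move=> /ereal_inf_lt[_ [k [k0 [a [Ma ya ak]]] <-]]; rewrite lte_fin => kd.
exists a => //; split=> // v; apply: (@le_trans _ _ (k * nrm v)).
  by have := ak v; rewrite !nrmE -rmorphM/= lecR.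
by rewrite ler_wpM2r ?nrm_ge0// ltW.
Qed.

End UniformNorm.

Lemma tails_cvg0 {R : realType} (Idx : Type) (le : Idx -> Idx -> Prop)
    (f : Idx -> \bar R) : (forall i, (0 <= f i)%E) ->
  (forall d : R, 0 < d -> exists g, forall i, le g i -> (f i <= d%:E)%E) ->
  f @ tails le --> 0%E.
Proof.
move=> f0 hf A [e /= e0 eA].
have [g hg] := hf (e / 2) (divr_gt0 e0 (ltr0n _ 2)).
exists g => // i /hg; have := f0 i; rewrite /=.
case: (f i) => [r| |]//; rewrite !lee_fin => r0 re.
apply: eA; rewrite /= sub0r normrN ger0_norm//; lra.
Qed.

(** * Completeness *)

Section Completeness.
Context {R : realType} {H : completeNormedModType R[i]}.
Context (dot : {dot H for conjC}) (hdot : induces_norm dot).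
Context (M : set (H -> H)) (hM : von_neumann_algebra dot M).
Context (tau : (H -> H) -> \bar R) (htau : fns_trace dot M tau).
Implicit Types (u v w z : H) (a b c e f g h p q T : H -> H) (K : set H).
Implicit Types (x y G : set (H * H)).
Local Notation ip := (reip dot).
Local Notation M' := (commutant M).
Local Notation is_proj := (is_proj dot M).
Local Notation L0 := (L0 dot M tau).
Local Notation tame := (tame dot M tau).

(** The projection on the left of [x_i - x_j]: none for a.u., [e] itself for
b.a.u. *)
Definition left_factor (one_sided : bool) e : H -> H := if one_sided then id else e.

Lemma left_factor_M m e : is_proj e -> M (left_factor m e).
Proof. by move=> pe; case: m => /=; [exact: (M_id hM)|exact: proj_M pe]. Qed.

Lemma left_factor_contr m e v : is_proj e -> nrm (left_factor m e v) <= nrm v.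
Proof. by move=> pe; case: m => //=; exact: (proj_contr hdot v pe). Qed.

Lemma left_factor_proj m e v : is_proj e -> e (left_factor m e v) = e v.
Proof. by move=> pe; case: m => //=; exact: (proj_idem _ pe). Qed.

Lemma left_factor_sub m p q v : is_proj p -> is_proj q ->
  (forall v, p v = v -> q v = v) ->
  left_factor m p (left_factor m q v) = left_factor m p v.
Proof. by move=> pp pq h; case: m => //=; exact: (proj_subr hdot v pp pq h). Qed.

(** [left_factor m e] times y times e, with strong products, in the two forms in
which the definitions of convergence and of Cauchy nets use it. *)
Definition compress (m : bool) e y : set (H * H) :=
  if m then L0_mul y (op_graph e) else L0_mul (op_graph e) (L0_mul y (op_graph e)).

(** The strong product of y and e is densely defined by [tau_dense_preimage], so
a bounded operator that agrees with it where it is defined is equal to its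
closure. *)
Lemma compress_graph m e y a : is_proj e -> tame y -> M a ->
  compress m e y = op_graph a <->
  forall v z, y (e v, z) -> left_factor m e z = a v.
Proof.
move=> pe ty Ma; have bae := M_bd hM Ma; have be := M_bd hM (proj_M pe).
have in_mul v z : y (e v, z) -> L0_mul y (op_graph e) (v, z).
  by move=> yz; apply: subset_closure; exists (e v).
split.
  case: m => /= E v z yz.
    by have : op_graph a (v, z); [rewrite -E; exact: in_mul|].
  have : op_graph a (v, e z); last by [].
  by rewrite -E; apply: subset_closure; exists z => //; exact: in_mul.
move=> ya.
have mul_a v k : L0_mul y (op_graph e) (v, k) -> left_factor m e k = a v.
  move=> /closure_seqP[s [hs sv]].
  apply: (tends_unique (tends_op (M_bd hM (left_factor_M m pe)) (tends_snd sv))).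
  have -> : (fun n => left_factor m e (s n).2) = fun n => a (s n).1.
    by apply/funext => n; have [w wE yw] := hs n; apply: ya; rewrite -[e _]wE.
  exact: (tends_op bae (tends_fst sv)).
have [sy iy ry _] := ty.
have sD : subsp (op_dom y).
  split; first by exists 0; exact: sy.1.
  by move=> c v v' [w yw] [w' yw']; exists (c *: w + w'); exact: (sy.2 c _ _ yw yw').
have dW u : closure [set u | op_dom y (e u)] u.
  apply: (tau_dense_preimage hdot hM htau (proj_M pe) sD) => eps /ry[f [b [pf Mb tf yb]]].
  by exists f; split=> // v; exists (b v).
apply/seteqP; split=> [[v k] vk|[v k]]; last rewrite /op_graph/= => ->.
  case: m ya mul_a vk => /= ya mul_a vk; first exact: mul_a.
  apply: (closed_op_graph bae).
  apply: closureS vk => -[v' k'] [w /mul_a/= wv kE].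
  by rewrite /op_graph/= -wv; exact: kE.
have /closure_seqP[s [hs sv]] := dW v.
have [z hz] := choice hs.
have sa : tends (fun n => (s n, a (s n))) (v, a v).
  by apply: tends_pair => //; exact: tends_op.
have ya' n := ya _ _ (hz n).
case: m ya mul_a ya' => /= ya mul_a ya'; apply/closure_seqP;
  exists (fun n => (s n, a (s n))); split=> // n.
  by exists (e (s n)) => //=; rewrite -ya'.
by exists (z n); [exact: (in_mul _ _ (hz n))|rewrite /op_graph/= ya'].
Qed.

(** On vectors v in the range of e on which [e^perp (x - y)] vanishes,
[(x - y) v = e p (x - y) e v = e (a v)], where p is the left factor. These vectors
are the range of the meet of e, of two projections that make x and y bounded,
and of a kernel of co-trace at most [2 d]. *)
Lemma bounded_step m x y e a (c d : R) : L0 x -> L0 y -> is_proj e -> M a -> 0 < d ->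
  (tau (perp e) <= d%:E)%E -> (forall v, nrm (a v) <= c * nrm v) ->
  (forall v z, L0_sub x y (e v, z) -> left_factor m e z = a v) ->
  exists h, [/\ is_proj h, (tau (perp h) <= (9 * d)%:E)%E &
    forall v, h v = v -> exists w w', [/\ x (v, w), y (v, w') & nrm (w - w') <= c * nrm v]].
Proof.
move=> Lx Ly pe Ma d0 te ac ya.
have [_ _ /(_ _ d0)[e1 [b1 [pe1 Mb1 te1 xb1]]] _] := L0_tame hdot hM htau Lx.
have [_ _ /(_ _ d0)[e2 [b2 [pe2 Mb2 te2 yb2]]] _] := L0_tame hdot hM htau Ly.
have pe' := perp_proj hM pe.
have Mk : M (fun v => perp e (b1 v - b2 v)).
  by apply: (M_comp hM (proj_M pe')); exact: (M_sub hM).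
have [k pk hk] := ker_proj hdot hM Mk.
have tk := tau_ker hdot hM htau Mk pk hk pe' (fun v => proj_idem _ pe') te.
have [h1 [ph1 th1 h1e h1e1]] := proj_cap2 hdot hM htau pe pe1 te te1.
have [h2 [ph2 th2 h2h1 h2e2]] := proj_cap2 hdot hM htau ph1 pe2 th1 te2.
have [h [ph th hh2 hk']] := proj_cap2 hdot hM htau ph2 pk th2 tk.
(* d for e, 2 d for each of e1 and e2, and 2 (2 d) for the kernel k. *)
exists h; split=> //; first by apply: le_trans th _; rewrite lee_fin; lra.
move=> v hv; have v2 := hh2 _ hv; have v1 := h2h1 _ v2.
have xv : x (v, b1 v) by rewrite -[X in (X, _)](h1e1 _ v1).
have yv : y (v, b2 v) by rewrite -[X in (X, _)](h2e2 _ v2).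
exists (b1 v), (b2 v); split=> //.
have ez : e (b1 v - b2 v) = b1 v - b2 v by apply/(perpE _ pe); apply/hk; exact: hk'.
have zE : left_factor m e (b1 v - b2 v) = a v.
  apply: ya; rewrite (h1e _ v1); apply: subset_closure.
  by exists (b1 v), (b2 v).
rewrite -ez -(left_factor_proj m _ pe) zE.
by apply: le_trans (ac v); exact: (proj_contr hdot _ pe).
Qed.

Section Directed.
Context (Idx : Type) (le : Idx -> Idx -> Prop) (hle : directed_set le).

Lemma upper_bound (s : nat -> Idx) (i : Idx) n :
  exists j, le i j /\ forall m, (m <= n)%N -> le (s m) j.
Proof.
have [_ refl trans ub] := hle.
elim: n => [|n [j [ij sj]]].
  by have [j ij sj] := ub i (s 0%N); exists j; split=> // m; rewrite leqn0 => /eqP ->.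
have [k jk sk] := ub j (s n.+1); exists k; split; first exact: trans jk.
move=> m; rewrite leq_eqVlt => /orP[/eqP ->//|]; rewrite ltnS => /sj mj.
exact: trans jk.
Qed.

Lemma cofinal_sequence (g : nat -> nat -> Idx) : exists s : nat -> Idx,
  (forall k, le (s k) (s k.+1)) /\ forall m k, (m <= k)%N -> le (g m k) (s k).
Proof.
have [[i0] _ _ _] := hle.
have /choice[step hstep] : forall ki : nat * Idx, exists j, le ki.2 j /\
    forall m, (m <= ki.1)%N -> le (g m ki.1) j.
  by move=> [k i]; exact: upper_bound (g ^~ k) i k.
pose s := fix s k := if k is l.+1 then step (l.+1, s l) else step (0%N, i0).
exists s; split=> [k|m [|k] mk]; first exact: (hstep (k.+1, s k)).1.
  exact: (hstep (0%N, i0)).2.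
exact: (hstep (k.+1, s k)).2.
Qed.

End Directed.

Section Limit.
Context (x : nat -> set (H * H)) (Lx : forall k, L0 (x k)).
Context (h : nat -> H -> H) (d : R) (ph : forall k, is_proj (h k)).
Context (th : forall k, (tau (perp (h k)) <= (d * 2 ^- k)%:E)%E).
Context (hx : forall k v, h k v = v -> exists w w',
  [/\ x k.+1 (v, w), x k (v, w') & nrm (w - w') <= 2 ^- k * nrm v]).

(** On the range of [f n] all [x k] with [k >= n] are defined and bounded, and
consecutive ones differ by at most [2^-k]. The operators [b n] are the limits of
their restrictions, and the bounded operators [c n k] those restrictions
themselves; the limit relation is tame by [left_bound]. *)
Lemma limit_operator : exists xh (f : nat -> H -> H) (b : nat -> H -> H)
    (c : nat -> nat -> H -> H), L0 xh /\ forall n,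
  [/\ is_proj (f n), (tau (perp (f n)) <= (4 * d * 2 ^- n)%:E)%E, M (b n),
    forall v, f n v = v -> xh (v, b n v)
  & forall k, M (c n k) /\ ((n <= k)%N -> forall v, f n v = v ->
      x k (v, c n k v) /\ nrm (b n v - c n k v) <= 2 * 2 ^- k * nrm v)].
Proof.
have [f hf] := proj_tails hdot hM htau ph th.
have pf n : is_proj (f n) by case: (hf n).
have fE n v : f n v = v <-> forall m, (n <= m)%N -> h m v = v by case: (hf n).
have ff n v : f n (f n v) = f n v by exact: (proj_idem _ (pf n)).
have fmono m n v : (m <= n)%N -> f m v = v -> f n v = v.
  by move=> mn /fE h1; apply/fE => k nk; apply: h1; exact: leq_trans nk.
have tx k := L0_tame hdot hM htau (Lx k).
have inj k v w w' : x k (v, w) -> x k (v, w') -> w = w' by exact: (tame_inj hdot hM htau (tx k)).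
have /choice[c hc] : forall nk : nat * nat, exists b, M b /\
    ((nk.1 <= nk.2)%N -> forall v, x nk.2 (f nk.1 v, b v)).
  move=> [n k] /=; case: (leqP n k) => nk; last by exists id; split=> //; exact: (M_id hM).
  have [lx cx _ _ _] := Lx k; have [_ ix _ _] := tx k.
  have [v|b Mb xb] := everywhere_defined_bounded hdot hM lx cx ix (pf n); last by exists b.
  have hk : h k (f n v) = f n v by move/fE: (ff n v); exact.
  by have [_ [w [_ xw _]]] := hx hk; exists w.
have Mc n k : M (c (n, k)) by case: (hc (n, k)).
have xc n k v : (n <= k)%N -> f n v = v -> x k (v, c (n, k) v).
  by move=> nk fv; rewrite -[X in (X, _)]fv; exact: (hc (n, k)).2.
have cf n k v : (n <= k)%N -> c (n, k) (f n v) = c (n, k) v.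
  by move=> nk; apply: (inj k (f n v)); [exact: xc|exact: (hc (n, k)).2].
have /choice[b hb] : forall nv : nat * H, exists l,
    tends (fun k => c (nv.1, (nv.1 + k)%N) nv.2) l /\
    forall k, nrm (l - c (nv.1, (nv.1 + k)%N) nv.2) <= 2 * 2 ^- (nv.1 + k) * nrm nv.2.
  move=> [n v] /=; apply: telescope_tends => [k|k|eps e0].
  - have hk : h (n + k)%N (f n v) = f n v.
      by move/fE: (ff n v); apply; exact: leq_addr.
    have [w [w' [xw xw' ww']]] := hx hk.
    have nk : (n <= n + k)%N by exact: leq_addr.
    rewrite -addnS in xw.
    have wE : w = c (n, (n + k.+1)%N) v.
      by apply: inj xw _; apply: (hc (n, _)).2; exact: leq_addr.
    have w'E : w' = c (n, (n + k)%N) v by apply: inj xw' _; exact: (hc (n, _)).2.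
    rewrite -wE -w'E; apply: le_trans ww' _.
    have := proj_contr hdot v (pf n); rewrite addnS exprS invfM.
    have : 0 < 2 ^- (n + k) :> R by rewrite invr_gt0 exprn_gt0.
    by move: (2 ^- (n + k)) (nrm v) (nrm (f n v)) => r s t *; nra.
  - by rewrite !mulr_ge0 ?nrm_ge0// invr_ge0 exprn_ge0.
  - have C0 : 0 < 2 * nrm v + 1 by have := nrm_ge0 v; lra.
    have [n0 h0] := half_small (divr_gt0 e0 C0); exists n0.
    have := h0 _ (leq_addl n n0); rewrite ltr_pdivlMr// mulrAC mulrC.
    have : 0 < 2 ^- (n + n0) :> R by rewrite invr_gt0 exprn_gt0.
    by move: (2 ^- (n + n0)) => r *; nra.
pose B n v := b (n, v).
have Bt n v : tends (fun k => c (n, (n + k)%N) v) (B n v) by exact: (hb (n, v)).1.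
have Bd n k v : (n <= k)%N -> nrm (B n v - c (n, k) v) <= 2 * 2 ^- k * nrm v.
  by move=> /subnKC <-; exact: (hb (n, v)).2.
have lB n : linear (B n).
  move=> e u v; apply: (tends_unique (Bt n _)).
  have -> : (fun k => c (n, (n + k)%N) (e *: u + v)) =
      fun k => e *: c (n, (n + k)%N) u + c (n, (n + k)%N) v.
    by apply/funext => k; rewrite (M_lin hM (Mc _ _)).
  by apply: tends_lin; exact: Bt.
have MB n : M (B n).
  apply: (M_intro hM) => [|e Me v].
    have [C C0 cC] := bounded_bound (M_bd hM (Mc n n)).
    apply: (@bound_bounded _ _ _ (2 * 2 ^- n + C)) => // v.
    have := Bd n n v (leqnn n); have := cC v.
    by have := nrm_dist (B n v) (c (n, n) v) 0; rewrite !subr0 mulrDl; lra.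
  apply: (tends_unique (tends_op (comm_bd Me) (Bt n v))).
  have -> : (fun k => e (c (n, (n + k)%N) v)) = fun k => c (n, (n + k)%N) (e v).
    by apply/funext => k; rewrite (comm_swap _ (Mc _ _) Me).
  exact: Bt.
have BS n v : f n v = v -> B n.+1 v = B n v.
  move=> fv; apply: (tends_unique (Bt n.+1 v)).
  have := tends_shift 1 (Bt n v).
  congr (tends _ _); apply/funext => k; rewrite addn1 addnS -addSn.
  apply: (inj (n.+1 + k)%N v); apply: xc => //; rewrite ?leq_addr//.
    by rewrite addSnnS leq_addr.
  exact: fmono (leqnSn n) fv.
have Bmono m n v : (m <= n)%N -> f m v = v -> B n v = B m v.
  move=> /subnKC <- fv; elim: (n - m)%N => [|k IH]; first by rewrite addn0.
  by rewrite addnS BS// (fmono m)// leq_addr.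
pose G := [set p | exists n, f n p.1 = p.1 /\ p.2 = B n p.1].
have Gf n v : f n v = v -> G (v, B n v) by move=> fv; exists n.
have tG : tame G.
  split.
  - split.
      exists 0%N; split; first exact: (lin0 (proj_lin hM (pf 0%N))).
      exact/esym/(lin0 (lB 0%N)).
    move=> e [u u'] [v v'] [m [/= fu ->]] [n [/= fv ->]]; exists (maxn m n) => /=.
    have fu' := fmono _ _ _ (leq_maxl m n) fu; have fv' := fmono _ _ _ (leq_maxr m n) fv.
    rewrite (proj_lin hM (pf _)) fu' fv' lB; split=> //.
    by rewrite (Bmono _ _ _ (leq_maxl m n) fu) (Bmono _ _ _ (leq_maxr m n) fv).
  - move=> e Me v w [n [/= fv ->]]; exists n => /=.
    by rewrite (comm_swap _ (proj_M (pf n)) Me) fv (comm_swap _ (MB n) Me).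
  - move=> eps e0; have C0 : 0 < 4 * `|d| + 1 by have := normr_ge0 d; lra.
    have [n hn] := half_small (divr_gt0 e0 C0).
    exists (f n), (fun v => B n (f n v)); split=> //.
    + by apply: (M_comp hM) => //; exact: proj_M.
    + have [_ _ tf] := hf n; apply: le_trans tf _; rewrite lee_fin.
      have := hn n (leqnn n); rewrite ltr_pdivlMr//.
      have : 0 < 2 ^- n :> R by rewrite invr_gt0 exprn_gt0.
      by have := ler_norm d; move: (2 ^- n) => r *; nra.
    + by move=> v; apply: Gf.
  - move=> eps e0.
    have [|||q [e [pq Me tq qe]]] := @left_bound _ _ _ hdot _ hM _ htau f B (4 * d) pf _ _ MB _ eps e0.
    + by move=> n v; exact: (fmono n).
    + by move=> n; case: (hf n).
    + move=> n v; rewrite BS//; apply: (tends_unique (Bt n _)).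
      have -> : (fun k => c (n, (n + k)%N) (f n v)) = fun k => c (n, (n + k)%N) v.
        by apply/funext => k; rewrite cf// leq_addr.
      exact: Bt.
    exists q, e; split=> // v w [n [/= fv ->]]; exact: qe.
exists (closure G), f, B, (fun n k => c (n, k)); split.
  apply: (tame_L0 hdot hM htau); last exact: closed_closure.
  exact: (tame_closure hM).
move=> n; split=> //; first by case: (hf n).
- by move=> v fv; apply: subset_closure; exact: Gf.
- by move=> k; split=> // nk v fv; split; [exact: xc|exact: Bd].
Qed.

End Limit.

(** The condition [unorm (compress m e (L0_sub x y)) <= d], freed from closures
by [compress_graph]. *)
Definition uniformly_small m e x y (d : R) := exists2 a, M a &
  (forall v, nrm (a v) <= d * nrm v) /\
  forall v z, L0_sub x y (e v, z) -> left_factor m e z = a v.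

(** On the meet of [e n] and [f n], the difference [xh - x i] is the sum of
[xh - x (s k)], uniformly small by construction of [xh], and [x (s k) - x i],
small by the Cauchy condition for [e n]; [sub_cancel] makes this splitting
legitimate for vectors in the domain of the strong difference only. *)
Lemma complete_net (m : bool) (Idx : Type) (le : Idx -> Idx -> Prop) (x : Idx -> set (H * H)) :
  directed_set le -> (forall i, L0 (x i)) ->
  (forall eps : R, 0 < eps -> exists e, [/\ is_proj e, (tau (perp e) <= eps%:E)%E &
     forall d : R, 0 < d -> exists g : Idx, forall i j, le g i -> le g j ->
       uniformly_small m e (x i) (x j) d]) ->
  exists xh, L0 xh /\
    forall eps : R, 0 < eps -> exists e, [/\ is_proj e, (tau (perp e) <= eps%:E)%E &
     forall d : R, 0 < d -> exists g : Idx, forall i, le g i ->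
       uniformly_small m e xh (x i) d].
Proof.
move=> hle Lx cx; have [_ refl trans _] := hle.
have h2 n : 0 < 2 ^- n :> R by rewrite invr_gt0 exprn_gt0.
have /choice[e he] := fun n => cx _ (h2 n).
have pe n : is_proj (e n) by case: (he n).
have te n : (tau (perp (e n)) <= (2 ^- n)%:E)%E by case: (he n).
have /choice[g hg] : forall nk : nat * nat, exists g : Idx, forall i j, le g i -> le g j ->
    uniformly_small m (e nk.1) (x i) (x j) (2 ^- nk.2).
  by move=> [n k]; have [_ _ h] := he n; exact: h.
have [s [sS gs]] := cofinal_sequence hle (fun n k => g (n, k)).
have /choice[h hh] : forall k, exists h, [/\ is_proj h,
    (tau (perp h) <= (9 * 2 ^- k)%:E)%E &
    forall v, h v = v -> exists w w',
      [/\ x (s k.+1) (v, w), x (s k) (v, w') & nrm (w - w') <= 2 ^- k * nrm v]].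
  move=> k; have gk := gs k k (leqnn k).
  have [a Ma [ac ya]] := hg (k, k) (s k.+1) (s k) (trans _ _ _ gk (sS k)) gk.
  exact: (bounded_step (Lx _) (Lx _) (pe k) Ma (h2 k) (te k) ac ya).
have [xh [f [b [c [Lxh hf]]]]] := @limit_operator (fun k => x (s k)) (fun k => Lx (s k)) h 9
  (fun k => let: And3 p _ _ := hh k in p) (fun k => let: And3 _ t _ := hh k in t)
  (fun k => let: And3 _ _ y := hh k in y).
exists xh; split=> // eps e0.
(* The meet of e n and f n has co-trace at most 2^-n + 2 (4 * 9 * 2^-n) = 73 * 2^-n. *)
have [n hn] := half_small (divr_gt0 e0 (ltr0n R 100)).
have [pf tf Mb xb hc] := hf n.
have [p [pp tp hpe hpf]] := proj_cap2 hdot hM htau (pe n) pf (te n) tf.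
exists p; split=> //.
  apply: le_trans tp _; rewrite lee_fin; have := hn n (leqnn n).
  by rewrite ltr_pdivlMr//; move: (2 ^- n) => r; lra.
move=> d d0; have [k0 hk0] := half_small (divr_gt0 d0 (ltr0n R 3)).
pose k := maxn n k0; have nk : (n <= k)%N by exact: leq_maxl.
have kd : 2 ^- k < d / 3 by apply: hk0; exact: leq_maxr.
have [Mc xc] := hc k.
exists (s k) => i ski; have gk := gs n k nk.
have [a Ma [ac ya]] := hg (n, k) (s k) i gk (trans _ _ _ gk ski).
have lp := M_lin hM (left_factor_M m (pe n)).
exists (fun v => left_factor m p (a (p v) +
  left_factor m (e n) (b n (p v) - c n k (p v)))).
  apply: (M_comp hM) (left_factor_M m pp) _.
  apply: (M_add hM); first exact: (M_comp hM Ma (proj_M pp)).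
  apply: (M_comp hM (left_factor_M m (pe n))).
  by apply: (M_sub hM); [exact: (M_comp hM Mb (proj_M pp))|exact: (M_comp hM Mc (proj_M pp))].
split=> v.
  apply: le_trans (left_factor_contr _ _ pp) _; apply: le_trans (nrmD _ _) _.
  have fpv : f n (p v) = p v by apply: hpf; exact: (proj_idem _ pp).
  have := ac (p v); have := left_factor_contr m (b n (p v) - c n k (p v)) (pe n).
  have [_] := xc nk _ fpv; have := proj_contr hdot v pp; have := nrm_ge0 (p v).
  have := h2 k; rewrite /=; move: (2 ^- k) kd (nrm (p v)) (nrm v) => r rd t u.
  by move: (nrm _) (nrm _) (nrm _) => l1 l2 l3 *; nra.
move=> z; set u := p v => uz; have pu : p u = u by exact: (proj_idem _ pp).
have eu := hpe _ pu; have fu := hpf _ pu.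
have xiu := sub_cancel hdot hM htau Lxh (Lx i) uz (xb _ fu).
have [xku _] := xc nk _ fu.
have : L0_sub (x (s k)) (x i) (e n u, c n k u - (b n u - z)).
  rewrite eu; apply: subset_closure.
  by exists (c n k u), (b n u - z).
move=> /ya au; rewrite -au -(linD _ _ lp).
have -> : c n k u - (b n u - z) + (b n u - c n k u) = z.
  by rewrite addrC subrKA opprB addrC subrK.
by rewrite (left_factor_sub m z pp (pe n) hpe).
Qed.

End Completeness.

Theorem theorem2p2 (R : realType) (H : completeNormedModType R[i])
    (dot : {dot H for conjC}) (hdot : induces_norm dot)
    (M : set (H -> H)) (hM : von_neumann_algebra dot M)
    (tau : (H -> H) -> \bar R) (htau : fns_trace dot M tau)
    (htau1 : tau id = +oo%E)
    (Idx : Type) (le : Idx -> Idx -> Prop) (hle : directed_set le)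
    (x : Idx -> set (H * H)) (hx : forall i, L0 dot M tau (x i)) :
  (au_cauchy dot M tau le x ->
     exists xh, L0 dot M tau xh /\ au_cvg dot M tau le x xh) /\
  (bau_cauchy dot M tau le x ->
     exists xh, L0 dot M tau xh /\ bau_cvg dot M tau le x xh).
Proof.
pose cauchy m := forall eps : R, 0 < eps -> exists e,
  [/\ projections dot M e, (tau (perp e) <= eps%:E)%E
    & forall d : R, 0 < d -> exists g, forall i j, le g i -> le g j ->
      (unorm M (compress m e (L0_sub (x i) (x j))) <= d%:E)%E].
pose cvg m xh := forall eps : R, 0 < eps -> exists e,
  [/\ projections dot M e, (tau (perp e) <= eps%:E)%E
    & (fun i => unorm M (compress m e (L0_sub xh (x i)))) @ tails le --> 0%E].
suff main m : cauchy m -> exists xh, L0 dot M tau xh /\ cvg m xh.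
  by split; [exact: (main true)|exact: (main false)].
move=> cx; have sub_tame y z := @L0_sub_tame _ _ _ hdot _ hM _ htau y z.
have [|xh [Lxh cxh]] := complete_net hdot hM htau (m := m) hle hx.
  move=> eps /cx[e [pe te ce]]; exists e; split=> // d d0.
  have [g hg] := ce (d / 2) (divr_gt0 d0 (ltr0n _ 2)).
  exists g => i j gi gj.
  have dd : d / 2 < d by lra.
  have [a Ma [ea ac]] := unorm_le_graph (hg i j gi gj) dd.
  exists a => //; split=> //.
  exact: (proj1 (compress_graph hdot hM htau m pe (sub_tame _ _ (hx i) (hx j)) Ma) ea).
exists xh; split=> // eps /cxh[e [pe te ce]]; exists e; split=> //.
apply: tails_cvg0 => [i|d d0]; first exact: unorm_ge0.
have [g hg] := ce d d0; exists g => i /hg[a Ma [ac ya]].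
rewrite (proj2 (compress_graph hdot hM htau m pe (sub_tame _ _ Lxh (hx i)) Ma) ya).
by apply: unorm_graph_le => //; exact: ltW.
Qed.
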